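(* Let $\mathcal M$ be an $n$-dimensional Riemannian manifold of constant curvature $\varkappa$ (with the sign convention given in the context), and let $\gamma(x,t)$ be a family of curves on $\mathcal M$ satisfying a geometric evolution system of equations of the form $$\gamma_t=\sum_{l=1}^n h^{(l)}\mathbf e_l,$$ where $\{\mathbf e_l,\ l=1,\dots,n\}$ is the natural frame of $\gamma$ and where the $h^{(l)}$ are arbitrary smooth functions of the curvatures $u^{(i)}$, $i=1,\dots,n-1$, and their derivatives with respect to $x$. Assume that $x$ is the arc-length parameter and that the evolution is arc-length preserving. Then the curvatures $\mathbf u=(u^{(1)},\dots,u^{(n-1)})^{\intercal}$ satisfy the evolution $$\mathbf u_t=\Re\,\mathbf h-\varkappa\,\mathbf h,\qquad \mathbf h=(h^{(2)},\dots,h^{(n)})^{\intercal},$$ where the operator $$\Re=D_x^2+\langle\mathbf u,\mathbf u\rangle+\mathbf u_1D_x^{-1}\langle\mathbf u,\cdot\rangle-\sum_{1\le i<j\le n-1}J_{ij}\mathbf u\,D_x^{-1}\langle J_{ij}\mathbf u_1,\cdot\rangle$$ is hereditary. Moreover $\Re=\mathfrak H\,\mathfrak I$, where $$\mathfrak I=D_x+\mathbf u\,D_x^{-1}\mathbf u^{\intercal}$$ is a symplectic operator and $$\mathfrak H=D_x+\sum_{1\le i<j\le n-1}J_{ij}\mathbf u\,D_x^{-1}(J_{ij}\mathbf u)^{\intercal}$$ is a cosymplectic (Hamiltonian) operator.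
   Context: Geometry. The natural (parallel) frame $\mathbf e_1,\dots,\mathbf e_n$ along an arc-length parametrized curve is an orthonormal frame with $\mathbf e_1=\gamma_x$ and, with $\nabla$ the Levi-Civita connection, $\nabla_x\mathbf e_1=\sum_{i=1}^{n-1}u^{(i)}\mathbf e_{i+1}$, $\nabla_x\mathbf e_{i+1}=-u^{(i)}\mathbf e_1$ ($1\le i\le n-1$); the $u^{(i)}$ are its curvatures. Write $\nabla\mathbf e_i=\sum_j\omega_{ij}\otimes\mathbf e_j$, and let $\Omega=d\omega-\omega\wedge\omega$ be the curvature 2-form, so that $(\nabla_X\nabla_Y-\nabla_Y\nabla_X-\nabla_{[X,Y]})\mathbf e_i=\sum_j\Omega_{ij}(X,Y)\mathbf e_j$. Constant curvature $\varkappa$ means in this convention that $\Omega_{ij}(\mathbf e_k,\mathbf e_l)=\varkappa(\delta_{ik}\delta_{jl}-\delta_{il}\delta_{jk})$. Arc-length preservation is equivalent to $D_xh^{(1)}=\sum_{j=2}^n h^{(j)}u^{(j-1)}$. Operators. $D_x$ is the total $x$-derivative, $\mathbf u_k=D_x^k\mathbf u$, $\langle\cdot,\cdot\rangle$ is the standard inner product on $\mathbb R^{n-1}$, and $D_x^{-1}$ is the formal inverse of $D_x$, formally skew-adjoint; all integration constants are taken equal to zero (also when integrating the structure equations in $x$), and $\int$ is taken modulo total $x$-derivatives. An expression $\mathbf a D_x^{-1}\mathbf b^{\intercal}$ or $\mathbf aD_x^{-1}\langle\mathbf b,\cdot\rangle$ sends $P$ to $\mathbf a\,D_x^{-1}(\langle\mathbf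 b,P\rangle)$. $J_{ij}$ is the antisymmetric $(n-1)\times(n-1)$ matrix $(J_{ij})_{kl}=\delta_{ik}\delta_{jl}-\delta_{il}\delta_{jk}$. For an operator $A$ depending on $\mathbf u$, write $D_A[P]=A'[P]=\frac{d}{d\epsilon}\big|_{\epsilon=0}A(\mathbf u+\epsilon P)$ for its Fréchet derivative in direction $P$. - $\Re$ is hereditary if $\Re\,D_\Re[P](Q)-D_\Re[\Re P](Q)$ is symmetric in $P,Q$. - $\mathfrak I$ is symplectic if it is formally skew-adjoint and $\int\big(\langle\mathfrak I'[h_1]h_2,h_3\rangle+\langle\mathfrak I'[h_3]h_1,h_2\rangle+\langle\mathfrak I'[h_2]h_3,h_1\rangle\big)dx=0$ for all $h_1,h_2,h_3$. - $\mathfrak H$ is cosymplectic (Hamiltonian) if it is formally skew-adjoint and its Schouten bracket $[\mathfrak H,\mathfrak H]$ vanishes, i.e. $\int\big(\langle\xi_1,\mathfrak H'[\mathfrak H\xi_2]\xi_3\rangle+\text{cyclic permutations of }(1,2,3)\big)dx=0$ for all $\xi_1,\xi_2,\xi_3$ (equivalently, the bracket defined by $\mathfrak H$ satisfies the Jacobi identity). *)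

(* Defs.v *)
From HB Require Import structures.
From mathcomp Require Import all_boot all_order all_algebra.
From mathcomp Require Import all_classical all_reals all_analysis.

Set Implicit Arguments.
Unset Strict Implicit.
Unset Printing Implicit Defensive.

Import Order.TTheory GRing.Theory Num.Theory.
Import numFieldNormedType.Exports.

Local Open Scope classical_set_scope.
Local Open Scope ring_scope.

Definition dot (B : comNzRingType) (m : nat) (a b : 'cV[B]_m) : B :=
  \sum_(k < m) a k 0 * b k 0.

Definition Jmx (B : comNzRingType) (m : nat) (i j : 'I_m) : 'M[B]_m :=
  \matrix_(k, l) ((i == k)%:R * (j == l)%:R - (i == l)%:R * (j == k)%:R).

(** An operator depending on [u], acting on vectors over any commutative ring
    with a given [D] (for D_x) and [Di] (for D_x^-1).  Keeping the ring generic
    lets the same operator act on functions of x, on formal nonlocal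
    expressions, and on polynomials in a parameter epsilon over the latter. *)
Definition voperator (m : nat) : Type :=
  forall B : comNzRingType,
    (B -> B) -> (B -> B) -> 'cV[B]_m -> 'cV[B]_m -> 'cV[B]_m.

Definition Rop (m : nat) : voperator m := fun B D Di u h =>
  map_mx D (map_mx D h)
  + dot u u *: h
  + Di (dot u h) *: map_mx D u
  - \sum_(i < m) \sum_(j < m | (i < j)%N)
      Di (dot (Jmx B i j *m map_mx D u) h) *: (Jmx B i j *m u).

Definition Iop (m : nat) : voperator m := fun B D Di u h =>
  map_mx D h + Di (dot u h) *: u.

Definition Hop (m : nat) : voperator m := fun B D Di u h =>
  map_mx D h
  + \sum_(i < m) \sum_(j < m | (i < j)%N)
      Di (dot (Jmx B i j *m u) h) *: (Jmx B i j *m u).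

(** [grade d] consists of the expressions homogeneous of degree [d] in the
    test functions (the arguments of the operators); [grade 0] contains the
    differential functions of u.  D_x is invertible, with no integration
    constants, on the expressions of degree d, 0 < d < k.  The expressions of
    top degree k are those that are only integrated: D_x^-1 is not applied to
    them, so that "modulo total x-derivatives of degree k expressions" is a
    nontrivial relation although D_x is onto in the lower degrees.  Bilinear
    identities under the integral (skew-adjointness) live in k = 2, trilinear
    ones (closedness, the Jacobi identity) in k = 3.

    A concrete instance: u periodic in x, test functions h_i quasi-periodic,
    h_i(x + L) = r_i h_i(x), with r_1 ... r_k = 1 and no nonempty product of
    fewer than k multipliers (repetitions allowed) equal to 1; the integral is
    then the one over a period. *)
Record nonlocal_calculus (R : realType) (k : nat) := NonlocalCalculus {
  expr :> comAlgType R;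
  Dx : {linear expr -> expr};
  Dx_inv : expr -> expr;
  grade : nat -> set expr;
  Dx_leibniz : forall f g, Dx (f * g) = Dx f * g + f * Dx g;
  grade_0 : forall d, grade d 0;
  grade_1 : grade 0 1;
  grade_lin : forall d (a : R) f g,
    grade d f -> grade d g -> grade d (a *: f + g);
  grade_mul : forall d e f g,
    grade d f -> grade e g -> grade (d + e)%N (f * g);
  grade_Dx : forall d f, grade d f -> grade d (Dx f);
  grade_Dx_inv : forall d f,
    (0 < d < k)%N -> grade d f -> grade d (Dx_inv f);
  Dx_invK : forall d f, (0 < d < k)%N -> grade d f -> Dx (Dx_inv f) = f;
  DxK : forall d f, (0 < d < k)%N -> grade d f -> Dx_inv (Dx f) = f
}.

Definition vgrade (R : realType) (k : nat) (C : nonlocal_calculus R k) (m d : nat)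
    (v : 'cV[C]_m) : Prop :=
  forall i, grade d (v i 0).

Definition integral_zero (R : realType) (k : nat) (C : nonlocal_calculus R k)
    (f : C) : Prop :=
  exists2 g : C, grade k g & f = Dx C g.

Definition apply_op (m : nat) (F : voperator m) (R : realType) (k : nat)
    (C : nonlocal_calculus R k) (u h : 'cV[C]_m) : 'cV[C]_m :=
  F C (Dx C) (@Dx_inv _ _ C) u h.

(** d/d eps at eps = 0 of F(u + eps P) Q, with eps the variable ['X] of {poly C}
    and D_x, D_x^-1 extended to {poly C} coefficientwise. *)
Definition frechet (m : nat) (F : voperator m) (R : realType) (k : nat)
    (C : nonlocal_calculus R k) (u P Q : 'cV[C]_m) : 'cV[C]_m :=
  let inj := map_mx (polyC : C -> {poly C}) in
  map_mx (fun p : {poly C} => (p^`()).[0])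
    (F {poly C} (map_poly (Dx C)) (map_poly (@Dx_inv _ _ C))
       (inj u + 'X *: inj P) (inj Q)).

Definition hereditary (R : realType) (m : nat) (F : voperator m) : Prop :=
  forall (C : nonlocal_calculus R 3) (u P Q : 'cV[C]_m),
    vgrade 0 u -> vgrade 1 P -> vgrade 1 Q ->
    apply_op F u (frechet F u P Q) - frechet F u (apply_op F u P) Q =
    apply_op F u (frechet F u Q P) - frechet F u (apply_op F u Q) P.

Definition skew_adjoint (R : realType) (m : nat) (F : voperator m) : Prop :=
  forall (C : nonlocal_calculus R 2) (u P Q : 'cV[C]_m),
    vgrade 0 u -> vgrade 1 P -> vgrade 1 Q ->
    integral_zero (dot (apply_op F u P) Q + dot P (apply_op F u Q)).

Definition symplectic (R : realType) (m : nat) (F : voperator m) : Prop :=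
  skew_adjoint R F /\
  forall (C : nonlocal_calculus R 3) (u h1 h2 h3 : 'cV[C]_m),
    vgrade 0 u -> vgrade 1 h1 -> vgrade 1 h2 -> vgrade 1 h3 ->
    integral_zero (dot (frechet F u h1 h2) h3
                 + dot (frechet F u h3 h1) h2
                 + dot (frechet F u h2 h3) h1).

Definition cosymplectic (R : realType) (m : nat) (F : voperator m) : Prop :=
  skew_adjoint R F /\
  forall (C : nonlocal_calculus R 3) (u x1 x2 x3 : 'cV[C]_m),
    vgrade 0 u -> vgrade 1 x1 -> vgrade 1 x2 -> vgrade 1 x3 ->
    integral_zero (dot x1 (frechet F u (apply_op F u x2) x3)
                 + dot x2 (frechet F u (apply_op F u x3) x1)
                 + dot x3 (frechet F u (apply_op F u x1) x2)).

Definition factorizes (R : realType) (m : nat) (F G K : voperator m) : Prop :=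
  forall (C : nonlocal_calculus R 2) (u h : 'cV[C]_m),
    vgrade 0 u -> vgrade 1 h ->
    apply_op F u h = apply_op G u (apply_op K u h).

Fixpoint Ck (R : realType) (k : nat) (V W : normedModType R) (U : set V)
    (f : V -> W) : Prop :=
  if k is k'.+1 then
    (forall x, U x -> differentiable f x) /\
    (forall v : V, Ck k' U (fun x => 'D_v f x))
  else forall x, U x -> {for x, continuous f}.

Definition smooth_on (R : realType) (V W : normedModType R) (U : set V)
    (f : V -> W) : Prop :=
  forall k, Ck k U f.

Definition bilin (R : realType) (n : nat) (g : 'M[R]_n) (v w : 'rV[R]_n) : R :=
  (v *m g *m w^T) 0 0.

(** [chart_inv] is only meaningful on the image of the chart, and [metric i] is
    the Gram matrix of the metric in the coordinates of the i-th chart. *)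
Record riemannian_manifold (R : realType) (n : nat) := RiemannianManifold {
  mpoint :> topologicalType;
  chart_index : Type;
  dom : chart_index -> set mpoint;
  chart : chart_index -> mpoint -> 'rV[R]_n;
  chart_inv : chart_index -> 'rV[R]_n -> mpoint;
  metric : chart_index -> 'rV[R]_n -> 'M[R]_n;
  mfd_hausdorff : hausdorff_space mpoint;
  mfd_countable : @second_countable mpoint;
  dom_open : forall i, open (dom i);
  dom_cover : forall p, exists i, dom i p;
  chart_open : forall i, open (chart i @` dom i);
  chartK : forall i p, dom i p -> chart_inv i (chart i p) = p;
  chart_cont : forall i p, dom i p -> {for p, continuous (chart i)};
  chart_inv_cont : forall i y,
    (chart i @` dom i) y -> {for y, continuous (chart_inv i)};
  transition_smooth : forall i j,
    smooth_on (chart i @` (dom i `&` dom j)) (chart j \o chart_inv i);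
  metric_smooth : forall i, smooth_on (chart i @` dom i) (metric i);
  metric_sym : forall i y, (chart i @` dom i) y -> (metric i y)^T = metric i y;
  metric_pos : forall i y (v : 'rV[R]_n),
    (chart i @` dom i) y -> v != 0 -> 0 < bilin (metric i y) v v;
  metric_compat : forall i j p (v w : 'rV[R]_n), dom i p -> dom j p ->
    bilin (metric i (chart i p)) v w =
    bilin (metric j (chart j p)) ('D_v (chart j \o chart_inv i) (chart i p))
                                 ('D_w (chart j \o chart_inv i) (chart i p))
}.

Section Geometry.
Variables (R : realType) (n : nat) (M : riemannian_manifold R n).
Implicit Types (c : chart_index M) (y v w z : 'rV[R]_n).

Definition partial (a : 'I_n) (f : 'rV[R]_n -> R) (y : 'rV[R]_n) : R :=
  'D_(delta_mx 0 a) f y.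

(** Gamma^k_{ab} of the Levi-Civita connection in the chart [c]. *)
Definition christoffel c (k a b : 'I_n) y : R :=
  2^-1 * \sum_l invmx (metric c y) k l *
    (partial a (fun y' => metric c y' l b) y
     + partial b (fun y' => metric c y' l a) y
     - partial l (fun y' => metric c y' a b) y).

Definition conn c y v w : 'rV[R]_n :=
  \row_k \sum_a \sum_b christoffel c k a b y * v 0 a * w 0 b.

(** (nabla_v nabla_w - nabla_w nabla_v - nabla_[v,w]) z in the chart [c]. *)
Definition curv c y v w z : 'rV[R]_n :=
  \row_d \sum_a \sum_b \sum_k v 0 a * w 0 b * z 0 k *
    (partial a (christoffel c d b k) y - partial b (christoffel c d a k) y
     + \sum_l (christoffel c d a l y * christoffel c l b k y
               - christoffel c d b l y * christoffel c l a k y)).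

Definition orthonormal c y (E : 'I_n -> 'rV[R]_n) : Prop :=
  forall i j, bilin (metric c y) (E i) (E j) = (i == j)%:R.

(** Omega_ij(e_k, e_l) = <R(e_k, e_l) e_i, e_j>; with this ordering the
    sectional curvature is [- kap]. *)
Definition constant_curvature (kap : R) : Prop :=
  forall c p (E : 'I_n -> 'rV[R]_n), dom c p -> orthonormal c (chart c p) E ->
  forall i j k l,
    bilin (metric c (chart c p)) (curv c (chart c p) (E k) (E l) (E i)) (E j) =
    kap * ((i == k)%:R * (j == l)%:R - (i == l)%:R * (j == k)%:R).

(** A family of curves [gam x t], x in X, t in T; a vector field along it is
    given by its components in every chart. *)
Variables (X T : set R) (gam : R -> R -> M).

Definition smooth_family : Prop :=
  (forall x t, X x -> T t ->
     {for ((x, t) : R * R), continuous (fun z : R * R => gam z.1 z.2)}) /\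
  (forall c, smooth_on [set z : R * R | [/\ X z.1, T z.2 & dom c (gam z.1 z.2)]]
     (fun z : R * R => chart c (gam z.1 z.2))).

Definition vfield : Type := chart_index M -> R -> R -> 'rV[R]_n.

Definition vfield_along (V : vfield) : Prop :=
  (forall c c' x t, X x -> T t -> dom c (gam x t) -> dom c' (gam x t) ->
     V c' x t = 'D_(V c x t) (chart c' \o chart_inv c) (chart c (gam x t))) /\
  (forall c, smooth_on [set z : R * R | [/\ X z.1, T z.2 & dom c (gam z.1 z.2)]]
     (fun z : R * R => V c z.1 z.2)).

Definition along_eq (V W : vfield) : Prop :=
  forall c x t, X x -> T t -> dom c (gam x t) -> V c x t = W c x t.

Definition gam_x : vfield := fun c x t => derive1 (fun x' => chart c (gam x' t)) x.
Definition gam_t : vfield := fun c x t => derive1 (fun t' => chart c (gam x t')) t.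

Definition nabla_x (V : vfield) : vfield := fun c x t =>
  derive1 (fun x' => V c x' t) x + conn c (chart c (gam x t)) (gam_x c x t) (V c x t).
Definition nabla_t (V : vfield) : vfield := fun c x t =>
  derive1 (fun t' => V c x t') t + conn c (chart c (gam x t)) (gam_t c x t) (V c x t).

Definition lincomb (I : finType) (a : I -> R -> R -> R) (V : I -> vfield) :
    vfield :=
  fun c x t => \sum_i a i x t *: V i c x t.

(** |gam_x| = 1 for every t: x is the arc-length parameter and the evolution
    preserves it. *)
Definition arc_length_preserving : Prop :=
  forall c x t, X x -> T t -> dom c (gam x t) ->
    bilin (metric c (chart c (gam x t))) (gam_x c x t) (gam_x c x t) = 1.

End Geometry.

Section Frame.
Variables (R : realType) (m : nat) (M : riemannian_manifold R m.+1).
Variables (X T : set R) (gam : R -> R -> M).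

(** Indices are shifted: [e ord0] is e_1, and [e (lift ord0 i)] is the normal
    vector paired with the curvature [u i]. *)
Definition natural_frame (e : 'I_m.+1 -> vfield M) (u : 'I_m -> R -> R -> R) :
    Prop :=
  [/\ (forall a, vfield_along X T gam (e a)) /\
      (forall i, smooth_on [set z : R * R | X z.1 /\ T z.2]
                   (fun z : R * R => u i z.1 z.2)),
      forall c x t, X x -> T t -> dom c (gam x t) ->
        orthonormal c (chart c (gam x t)) (fun a => e a c x t),
      along_eq X T gam (e ord0) (gam_x gam),
      along_eq X T gam (nabla_x gam (e ord0))
        (lincomb u (fun i => e (lift ord0 i)))
    & forall i, along_eq X T gam (nabla_x gam (e (lift ord0 i)))
        (fun c x t => - (u i x t *: e ord0 c x t))].

End Frame.

Definition jet (R : realType) (m N : nat) (u : 'I_m -> R -> R -> R) (x t : R) :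
    'M[R]_(N.+1, m) :=
  \matrix_(k, i) derive1n k (fun x' => u i x' t) x.

Definition slice (R : realType) (m : nat) (f : 'I_m -> R -> R -> R) (t : R) :
    'cV[R -> R]_m :=
  \col_i (fun x => f i x t).

Definition ddx (R : realType) (f : R -> R) : R -> R := fun x => derive1 f x.

(** [Di] is the inverse of d/dx on the interval [X] without integration
    constants, [Z] being the class of functions of x whose integration constant
    is zero.  (E.g. the functions of x tending to 0 at the left end of X.) *)
Definition formal_inverse (R : realType) (X : set R) (Z : set (R -> R))
    (Di : (R -> R) -> (R -> R)) : Prop :=
  (forall f g, Z f -> Z g -> Z (f - g)) /\
  (forall f g : R -> R, Z f -> (forall x, X x -> is_derive x 1 f (g x)) ->
     forall x, X x -> Di g x = f x).

(* Main.v *)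
Require Import Defs.
From mathcomp Require Import all_boot all_order all_algebra.
From mathcomp Require Import all_classical all_reals all_analysis.
From mathcomp Require Import ring lra.
Set Implicit Arguments.
Unset Strict Implicit.
Unset Printing Implicit Defensive.
Import Order.TTheory GRing.Theory Num.Theory.
Import numFieldNormedType.Exports.
Local Open Scope classical_set_scope.
Local Open Scope ring_scope.

(** The proof has two independent halves.

    Geometry.  Along the map [y = chart c o gam] of the parameter plane into a
    chart, write [nabla_x e_a = sum_b A_ab e_b] and [nabla_t e_a = sum_b B_ab e_b];
    [A] holds the curvatures [u], [B] is the unknown connection form [om].  Since
    the frame is orthonormal, every coefficient is an inner product, and metric
    compatibility of the connection ([nabla_metric]) differentiates it.  The
    vanishing of torsion, [nabla_x gam_t = nabla_t gam_x], then gives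
    [h_b,x = B_0b + sum_d h_d A_bd] ([coframe_derive]), and the Ricci identity
    ([ricci_identity]) gives [B_x - A_t = Omega + B A^T - A B^T]
    ([structure_equation]).  For a natural frame these equations determine
    [om_0i = D_x h_i + h_0 u_i] and make
    [<J_ij u, h> - om_ij] an integral of [<J_ij u_x, h>], so that the first row,
    [u_i,t = D_x om_0i + sum_j u_j om_ij - kap h_i], becomes
    [u_t = Rop h - kap h] ([curvature_evolution]).  The analytic facts needed
    below this are the symmetry of second derivatives ([schwarz]) and the
    differentiability of the Christoffel symbols.

    Algebra.  By [sum_Jmx] the sums over [i < j] are products of one antisymmetric
    matrix with [u]: with [wedge a b = a b^T - b a^T],
      [Hop h = D h + Di (wedge h u) u],  [Iop h = D h + Di <u, h> u],
      [Rop h = D (Iop h) + Di (wedge (Iop h) u) u],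
    the last being the factorization [Hop Iop].  As [D] is injective on the degrees
    that occur, a nonlocal identity holds as soon as its derivative does, and an
    identity under the integral needs an explicit primitive:
    - closedness of [Iop]: the cyclic sum of [Di <u, h2> Di <h3, h1>];
    - Jacobi identity of [Hop]: with [W_a = Di (wedge x_a u)], the cyclic sum of
      [<x2, W1 x3>], half the trace of [[W1, W2] W3], and a correction that
      integrates the terms containing [Di (wedge x3 (Hop x2))] by parts.

    Heredity of [Rop] reads [Rop beta = Z] with
    [beta = Rop'[P] Q - Rop'[Q] P] and [Z = Rop'[Rop P] Q - Rop'[Rop Q] P].
    It expresses that the flows [u_t = Rop P] lift to zero-curvature pairs
    [(D - U, d_t - M_P)] of Euclidean motions, where the rotational part of [M_P]
    consists of [Iop P] and [V P = Di (wedge (Iop P) u)] and its translational part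
    of [Di <u, P>] and [P]: the commutator of two such flows lifts again, to a
    matrix computed from [M_P] and [M_Q], whose normal translation is [beta] up to
    sign.  In the proof this appears as three identities, for [Di <u, beta>], for
    [Iop beta] and for [Di (wedge (Iop beta) u)]; the nonlocal ones, the first and
    the last, are proved by differentiation. *)

(** * The matrices J_ij and exterior products *)

Section Wedge.
Variables (B : comNzRingType) (m : nat).
Implicit Types (a b c h u v : 'cV[B]_m) (A : 'M[B]_m).

Definition wedge a b : 'M[B]_m := a *m b^T - b *m a^T.

Lemma wedgeE a b i j : wedge a b i j = a i 0 * b j 0 - b i 0 * a j 0.
Proof. by rewrite !mxE !big_ord1 !mxE. Qed.

Lemma wedge_antisym a b i j : wedge a b j i = - wedge a b i j.
Proof. by rewrite !wedgeE; ring. Qed.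

Lemma wedge_diag a b i : wedge a b i i = 0.
Proof. by rewrite !wedgeE; ring. Qed.

Lemma dotC a b : dot a b = dot b a.
Proof. by apply: eq_bigr => k _; rewrite mulrC. Qed.

Lemma dot0r a : dot a 0 = 0.
Proof. by rewrite /dot big1 // => k _; rewrite mxE mulr0. Qed.

Lemma dotDl a b c : dot (a + b) c = dot a c + dot b c.
Proof. by rewrite /dot -big_split; apply: eq_bigr => k _; rewrite mxE mulrDl. Qed.

Lemma dotZl (s : B) a b : dot (s *: a) b = s * dot a b.
Proof. by rewrite /dot mulr_sumr; apply: eq_bigr => k _; rewrite mxE mulrA. Qed.

Lemma dotNl a b : dot (- a) b = - dot a b.
Proof. by rewrite -scaleN1r dotZl mulN1r. Qed.

Lemma dotDr a b c : dot a (b + c) = dot a b + dot a c.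
Proof. by rewrite !(dotC a) dotDl. Qed.

Lemma dotZr (s : B) a b : dot a (s *: b) = s * dot a b.
Proof. by rewrite !(dotC a) dotZl. Qed.

Lemma dotNr a b : dot a (- b) = - dot a b.
Proof. by rewrite !(dotC a) dotNl. Qed.

Lemma dot_suml (I : finType) (P : pred I) (F : I -> 'cV[B]_m) b :
  dot (\sum_(i | P i) F i) b = \sum_(i | P i) dot (F i) b.
Proof.
elim/big_rec2: _ => [|i x y _ IH]; first by rewrite dotC dot0r.
by rewrite dotDl IH.
Qed.

Lemma dot_sumr (I : finType) (P : pred I) (F : I -> 'cV[B]_m) b :
  dot b (\sum_(i | P i) F i) = \sum_(i | P i) dot b (F i).
Proof. by rewrite dotC dot_suml; apply: eq_bigr => i _; rewrite dotC. Qed.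

Lemma dot_mulmxl A a b : dot (A *m a) b = dot a (A^T *m b).
Proof.
rewrite /dot.
under eq_bigr do rewrite mxE mulr_suml.
under [RHS]eq_bigr do rewrite mxE mulr_sumr.
rewrite exchange_big; apply: eq_bigr => i _; apply: eq_bigr => j _.
by rewrite mxE; ring.
Qed.

Lemma wedgeMl a b c : wedge a b *m c = dot b c *: a - dot a c *: b.
Proof.
apply/matrixP => i j; rewrite ord1 !mxE /dot.
under eq_bigr => l _ do rewrite wedgeE mulrBl.
rewrite big_split /= !mulr_suml; congr (_ + _); first by apply: eq_bigr => l _; ring.
by rewrite -sumrN; apply: eq_bigr => l _; ring.
Qed.

Lemma JmxM i j v k : (Jmx B i j *m v) k 0 =
  (i == k)%:R * v j 0 - (j == k)%:R * v i 0.
Proof.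
rewrite mxE; under eq_bigr do rewrite mxE mulrBl.
rewrite big_split /= sumrN; congr (_ - _).
  rewrite (bigD1 j) //= eqxx mulr1 big1 ?addr0 // => l /negPf nl.
  by rewrite (eq_sym j) nl mulr0 mul0r.
rewrite (bigD1 i) //= eqxx mul1r big1 ?addr0 // => l /negPf nl.
by rewrite (eq_sym i) nl !mul0r.
Qed.

Lemma dot_Jmx i j v h : dot (Jmx B i j *m v) h = wedge h v i j.
Proof.
rewrite /dot wedgeE; under eq_bigr do rewrite JmxM mulrBl.
rewrite big_split /= sumrN; congr (_ - _).
  rewrite (bigD1 i) //= eqxx mul1r big1 ?addr0 1?mulrC // => l /negPf nl.
  by rewrite eq_sym nl !mul0r.
rewrite (bigD1 j) //= eqxx mul1r big1 ?addr0 // => l /negPf nl.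
by rewrite eq_sym nl !mul0r.
Qed.

(** The matrices [Jmx i j], [i < j], form a basis of the antisymmetric matrices,
    and [A] has the coordinates [A i j] in it. *)
Lemma sum_Jmx (A : 'M[B]_m) u :
  (forall i j, A j i = - A i j) -> (forall i, A i i = 0) ->
  \sum_(i < m) \sum_(j < m | (i < j)%N) A i j *: (Jmx B i j *m u) = A *m u.
Proof.
move=> Aas Ad; apply/matrixP => k l; rewrite {l}ord1 summxE [RHS]mxE.
under eq_bigr => i _.
  rewrite summxE; under eq_bigr => j _ do rewrite mxE JmxM mulrBr.
  rewrite big_split /= sumrN; over.
rewrite big_split /= sumrN.
have -> : \sum_(i < m) \sum_(j < m | (i < j)%N) A i j * ((i == k)%:R * u j 0)
   = \sum_(j < m | (k < j)%N) A k j * u j 0.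
  rewrite (bigD1 k) //= [X in _ + X]big1 ?addr0.
    by apply: eq_bigr => j _; rewrite eqxx mul1r.
  by move=> i /negPf ik; rewrite big1 // => j _; rewrite ik mul0r mulr0.
have -> : \sum_(i < m) \sum_(j < m | (i < j)%N) A i j * ((j == k)%:R * u i 0)
   = \sum_(i < m | (i < k)%N) A i k * u i 0.
  rewrite [RHS]big_mkcond; apply: eq_bigr => i _; case: ifP => ik.
    rewrite (bigD1 k) //= eqxx mul1r big1 ?addr0 // => j /andP[_ /negPf ->].
    by rewrite mul0r mulr0.
  rewrite big1 // => j ij; case: eqP => [jk|]; last by rewrite mul0r mulr0.
  by rewrite -jk ij in ik.
rewrite [RHS](bigID (fun j : 'I_m => (k < j)%N)) /=; congr (_ + _).
rewrite [RHS](bigD1 k) /= ?ltnn // Ad mul0r add0r -sumrN.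
apply: eq_big => [i|i _]; last by rewrite (Aas k i); ring.
by rewrite -leqNgt ltn_neqAle andbC.
Qed.

End Wedge.

(** * First variations as polynomials in a parameter *)

Section Pencil.
Variables (B : comNzRingType) (m : nat).
Implicit Types (a b Q : 'cV[B]_m) (s r : B) (A : 'M[B]_m).

Local Notation inj := (map_mx (polyC : B -> {poly B})).
(** [a + eps b], with the polynomial variable as [eps]. *)
Definition vpencil a b : 'cV[{poly B}]_m := inj a + 'X *: inj b.
Definition pencil s r : {poly B} := s%:P + 'X * r%:P.
(** The coefficient of the parameter: this is the operation applied by
    [frechet] to the value of an operator on a pencil. *)
Definition slope (V : 'cV[{poly B}]_m) : 'cV[B]_m :=
  map_mx (fun p : {poly B} => (p^`()).[0]) V.

Lemma coef0_pencil s r : (pencil s r)`_0 = s.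
Proof. by rewrite coefD coefC coefXM addr0. Qed.

Lemma coef1_pencil s r : (pencil s r)`_1 = r.
Proof. by rewrite coefD coefC coefXM coefC add0r. Qed.

Lemma coefn_pencil s r n : (pencil s r)`_n.+2 = 0.
Proof. by rewrite coefD coefC coefXM coefC addr0. Qed.

Lemma vpencilE a b i : vpencil a b i 0 = pencil (a i 0) (b i 0).
Proof. by rewrite !mxE. Qed.

Lemma vpencil0 a : inj a = vpencil a 0.
Proof. by rewrite /vpencil map_mx0 scaler0 addr0. Qed.

Lemma slopeE V i : slope V i 0 = (V i 0)`_1.
Proof. by rewrite mxE horner_coef0 coef_deriv. Qed.

Lemma slopeD V W : slope (V + W) = slope V + slope W.
Proof. by apply/matrixP => i j; rewrite ord1 slopeE !mxE !horner_coef0 !coef_deriv coefD. Qed.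

Lemma slopeN V : slope (- V) = - slope V.
Proof. by apply/matrixP => i j; rewrite ord1 slopeE !mxE !horner_coef0 !coef_deriv coefN. Qed.

Lemma slope_sum (I : finType) (P : pred I) F :
  slope (\sum_(i | P i) F i) = \sum_(i | P i) slope (F i).
Proof.
elim/big_rec2: _ => [|i x y _ IH]; last by rewrite slopeD IH.
by apply/matrixP => i j; rewrite ord1 slopeE !mxE coef0.
Qed.

Lemma slope_vpencil a b : slope (vpencil a b) = b.
Proof. by apply/matrixP => i j; rewrite ord1 slopeE vpencilE coef1_pencil. Qed.

Lemma coef1M (p q : {poly B}) : (p * q)`_1 = p`_0 * q`_1 + p`_1 * q`_0.
Proof. by rewrite coefM !big_ord_recl big_ord0 addr0. Qed.

Lemma slopeZ s r a b : slope (pencil s r *: vpencil a b) = s *: b + r *: a.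
Proof.
apply/matrixP => i j.
have E : (pencil s r *: vpencil a b) i 0 = pencil s r * vpencil a b i 0 by rewrite mxE.
by rewrite ord1 slopeE E coef1M vpencilE !coef0_pencil !coef1_pencil !mxE.
Qed.

(** [f] need not be additive: a pencil has only two coefficients, and all other
    coefficients are zero.  This is what lets the merely set-theoretic [Dx_inv]
    pass through. *)
Lemma map_pencil (f : B -> B) s r : f 0 = 0 ->
  map_poly f (pencil s r) = pencil (f s) (f r).
Proof.
move=> f0; apply/polyP => -[|[|n]]; rewrite coef_map_id0 //.
- by rewrite !coef0_pencil.
- by rewrite !coef1_pencil.
- by rewrite !coefn_pencil.
Qed.

Lemma map_vpencil (f : B -> B) a b : f 0 = 0 ->
  map_mx (map_poly f) (vpencil a b) = vpencil (map_mx f a) (map_mx f b).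
Proof.
by move=> f0; apply/matrixP => i j; rewrite ord1 mxE !vpencilE map_pencil // !mxE.
Qed.

Lemma dot_vpencil a b Q : dot (vpencil a b) (inj Q) = pencil (dot a Q) (dot b Q).
Proof.
rewrite /dot /pencil !rmorph_sum mulr_sumr -big_split; apply: eq_bigr => i _ /=.
by rewrite vpencilE mxE !polyCM /pencil; ring.
Qed.

Lemma coef1_dot_vpencil a b : (dot (vpencil a b) (vpencil a b))`_1 = dot a b *+ 2.
Proof.
rewrite /dot coef_sum -sumrMnl; apply: eq_bigr => i _.
by rewrite vpencilE coef1M coef0_pencil coef1_pencil; ring.
Qed.

Lemma Jmx_vpencil i j a b :
  Jmx {poly B} i j *m vpencil a b = vpencil (Jmx B i j *m a) (Jmx B i j *m b).
Proof.
apply/matrixP => k l; rewrite ord1 JmxM !vpencilE !JmxM /pencil.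
by rewrite !polyCB !polyCM !(rmorph_nat (@polyC B)); ring.
Qed.

End Pencil.

(** * Matrices over a nonlocal calculus *)

Lemma addmxE (V : nmodType) p q (A B : 'M[V]_(p, q)) i j :
  (A + B) i j = A i j + B i j.
Proof. exact: mxE. Qed.

Lemma oppmxE (V : zmodType) p q (A : 'M[V]_(p, q)) i j : (- A) i j = - A i j.
Proof. exact: mxE. Qed.

Lemma scalemxE (B : pzRingType) p q (a : B) (A : 'M[B]_(p, q)) i j :
  (a *: A) i j = a * A i j.
Proof. exact: mxE. Qed.

Lemma zeromxE (V : nmodType) p q i j : (0 : 'M[V]_(p, q)) i j = 0.
Proof. exact: mxE. Qed.

Lemma mapmxE (V W : Type) (f : V -> W) p q (A : 'M[V]_(p, q)) i j :
  map_mx f A i j = f (A i j).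
Proof. exact: mxE. Qed.

(* Products of matrices stay atoms for [ring]; unfolding them with [mxE] would
   replace them by sums. *)
Local Ltac mxring :=
  apply/matrixP => ? ?; rewrite !(addmxE, oppmxE, scalemxE, zeromxE); ring.

Section Calculus.
Variables (R : realType) (k : nat) (C : nonlocal_calculus R k).
Local Notation D := (Dx C).
Local Notation Di := (@Dx_inv R k C).
Implicit Types (f g : C) (d e m p q r : nat).

Lemma gradeD d f g : grade d f -> grade d g -> grade d (f + g).
Proof. by move=> /(grade_lin 1) H /H; rewrite scale1r. Qed.

Lemma gradeZ d (a : R) f : grade d f -> grade d (a *: f).
Proof. by move=> /(grade_lin a) /(_ (grade_0 _ _)); rewrite addr0. Qed.

Lemma gradeN d f : grade d f -> grade d (- f).
Proof. by rewrite -scaleN1r; apply: gradeZ. Qed.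

Lemma grade_sum d (I : finType) (P : pred I) (F : I -> C) :
  (forall i, P i -> grade d (F i)) -> grade d (\sum_(i | P i) F i).
Proof.
move=> H; apply: (big_ind (fun f => grade d f)) => //; first exact: grade_0.
by move=> f g; apply: gradeD.
Qed.

Lemma Di0 : (1 < k)%N -> Di 0 = 0.
Proof. by move=> k1; rewrite -{1}(raddf0 D) (@DxK _ _ C 1) //; apply: grade_0. Qed.

Definition mgrade d p q (A : 'M[C]_(p, q)) := forall i j, grade d (A i j).

Lemma vgradeP d m (v : 'cV[C]_m) : vgrade d v <-> mgrade d v.
Proof. by split=> H i; [move=> j; rewrite ord1|]; apply: H. Qed.

Lemma mgradeD d p q (A B : 'M[C]_(p, q)) :
  mgrade d A -> mgrade d B -> mgrade d (A + B).
Proof. by move=> HA HB i j; rewrite mxE; apply: gradeD. Qed.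

Lemma mgradeN d p q (A : 'M[C]_(p, q)) : mgrade d A -> mgrade d (- A).
Proof. by move=> HA i j; rewrite mxE; apply: gradeN. Qed.

Lemma mgradeB d p q (A B : 'M[C]_(p, q)) :
  mgrade d A -> mgrade d B -> mgrade d (A - B).
Proof. by move=> HA HB; apply: mgradeD => //; apply: mgradeN. Qed.

Lemma mgradeM d e n p q r (A : 'M[C]_(p, q)) (B : 'M[C]_(q, r)) :
  mgrade d A -> mgrade e B -> (d + e)%N = n -> mgrade n (A *m B).
Proof.
move=> HA HB <- i j; rewrite mxE; apply: grade_sum => l _.
exact: grade_mul.
Qed.

Lemma mgradeZ d e n p q f (A : 'M[C]_(p, q)) :
  grade d f -> mgrade e A -> (d + e)%N = n -> mgrade n (f *: A).
Proof. by move=> Hf HA <- i j; rewrite mxE; apply: grade_mul. Qed.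

Lemma mgrade_tr d p q (A : 'M[C]_(p, q)) : mgrade d A -> mgrade d A^T.
Proof. by move=> HA i j; rewrite mxE. Qed.

Lemma mgrade_Dx d p q (A : 'M[C]_(p, q)) : mgrade d A -> mgrade d (map_mx D A).
Proof. by move=> HA i j; rewrite mxE; apply: grade_Dx. Qed.

Lemma mgrade_Di d p q (A : 'M[C]_(p, q)) :
  (0 < d < k)%N -> mgrade d A -> mgrade d (map_mx Di A).
Proof. by move=> dk HA i j; rewrite mxE; apply: grade_Dx_inv. Qed.

Lemma mgrade_wedge d e n m (a b : 'cV[C]_m) :
  mgrade d a -> mgrade e b -> (d + e)%N = n -> mgrade n (wedge a b).
Proof.
move=> Ha Hb den; apply: mgradeB.
  exact: (mgradeM Ha (mgrade_tr Hb)).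
by apply: (mgradeM Hb (mgrade_tr Ha)); rewrite addnC.
Qed.

Lemma grade_dot d e n m (a b : 'cV[C]_m) :
  mgrade d a -> mgrade e b -> (d + e)%N = n -> grade n (dot a b).
Proof. by move=> Ha Hb <-; apply: grade_sum => i _; apply: grade_mul. Qed.

Lemma grade_tr d m (A : 'M[C]_m) : mgrade d A -> grade d (\tr A).
Proof. by move=> H; apply: grade_sum => i _. Qed.

Lemma mxDiK d p q (A : 'M[C]_(p, q)) :
  (0 < d < k)%N -> mgrade d A -> map_mx D (map_mx Di A) = A.
Proof. by move=> dk HA; apply/matrixP => i j; rewrite !mxE (Dx_invK dk). Qed.

Lemma mxDK d p q (A : 'M[C]_(p, q)) :
  (0 < d < k)%N -> mgrade d A -> map_mx Di (map_mx D A) = A.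
Proof. by move=> dk HA; apply/matrixP => i j; rewrite !mxE (DxK dk). Qed.

(** Nonlocal identities are proved by differentiating them; the additivity of
    [Dx_inv] on each degree is a first instance. *)
Lemma Dx_inj d f g : (0 < d < k)%N -> grade d f -> grade d g ->
  D f = D g -> f = g.
Proof. by move=> dk Hf Hg /(congr1 Di); rewrite !(DxK dk). Qed.

Lemma mxDx_inj d p q (A B : 'M[C]_(p, q)) : (0 < d < k)%N ->
  mgrade d A -> mgrade d B -> map_mx D A = map_mx D B -> A = B.
Proof. by move=> dk HA HB /(congr1 (map_mx Di)); rewrite !(mxDK dk). Qed.

Lemma mxDiD d p q (A B : 'M[C]_(p, q)) : (0 < d < k)%N ->
  mgrade d A -> mgrade d B -> map_mx Di (A + B) = map_mx Di A + map_mx Di B.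
Proof.
move=> dk HA HB; apply: (mxDx_inj dk).
- exact/mgrade_Di/mgradeD.
- by apply: mgradeD; apply: mgrade_Di.
- by rewrite map_mxD !(mxDiK dk) //; apply: mgradeD.
Qed.

Lemma mxDiN d p q (A : 'M[C]_(p, q)) : (0 < d < k)%N ->
  mgrade d A -> map_mx Di (- A) = - map_mx Di A.
Proof.
move=> dk HA; apply: (mxDx_inj dk).
- exact/mgrade_Di/mgradeN.
- exact/mgradeN/mgrade_Di.
- by rewrite map_mxN !(mxDiK dk) //; apply: mgradeN.
Qed.

Lemma mxDM p q r (A : 'M[C]_(p, q)) (B : 'M[C]_(q, r)) :
  map_mx D (A *m B) = map_mx D A *m B + A *m map_mx D B.
Proof.
apply/matrixP => i j; rewrite !mxE raddf_sum -big_split.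
by apply: eq_bigr => l _; rewrite /= !mxE Dx_leibniz.
Qed.

Lemma mxDZ p q f (A : 'M[C]_(p, q)) :
  map_mx D (f *: A) = D f *: A + f *: map_mx D A.
Proof. by apply/matrixP => i j; rewrite !mxE Dx_leibniz. Qed.

Lemma mxD_wedge m (a b : 'cV[C]_m) :
  map_mx D (wedge a b) = wedge (map_mx D a) b + wedge a (map_mx D b).
Proof.
rewrite /wedge map_mxB !mxDM !map_trmx; mxring.
Qed.

Lemma D_dot m (a b : 'cV[C]_m) :
  D (dot a b) = dot (map_mx D a) b + dot a (map_mx D b).
Proof.
rewrite /dot raddf_sum -big_split; apply: eq_bigr => i _.
by rewrite /= Dx_leibniz !mxE.
Qed.

Lemma D_mxtrace m (A : 'M[C]_m) : D (\tr A) = \tr (map_mx D A).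
Proof. by rewrite /mxtrace raddf_sum; apply: eq_bigr => i _; rewrite mxE. Qed.

(** * The operators and their first variations *)

Section Ops.
Variables (m : nat).
Implicit Types (u h P Q : 'cV[C]_m).

Lemma sum_Jmx_Di d u h v : (0 < d < k)%N -> mgrade d (wedge h v) ->
  \sum_(i < m) \sum_(j < m | (i < j)%N)
     Di (dot (Jmx C i j *m v) h) *: (Jmx C i j *m u)
  = map_mx Di (wedge h v) *m u.
Proof.
move=> dk H; have k1 : (1 < k)%N by case/andP: dk; apply: leq_ltn_trans.
rewrite -sum_Jmx.
- by apply: eq_bigr => i _; apply: eq_bigr => j _; rewrite dot_Jmx mapmxE.
- move=> i j; rewrite -oppmxE -(mxDiN dk H).
  by rewrite !mapmxE ?oppmxE wedge_antisym.
- by move=> i; rewrite mapmxE wedge_diag Di0.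
Qed.

Lemma HopE d u h : (0 < d < k)%N -> mgrade 0 u -> mgrade d h ->
  apply_op (@Hop m) u h = map_mx D h + map_mx Di (wedge h u) *m u.
Proof.
move=> dk Hu Hh; rewrite /apply_op /Hop (@sum_Jmx_Di d) //.
exact: mgrade_wedge Hh Hu (addn0 d).
Qed.

Lemma IopE u h : apply_op (@Iop m) u h = map_mx D h + Di (dot u h) *: u.
Proof. by []. Qed.

Lemma mgrade_Iop d u h : (0 < d < k)%N -> mgrade 0 u -> mgrade d h ->
  mgrade d (apply_op (@Iop m) u h).
Proof.
move=> dk Hu Hh; apply: mgradeD; first exact: mgrade_Dx.
exact: (mgradeZ (grade_Dx_inv dk (grade_dot Hu Hh (add0n d))) Hu (addn0 d)).
Qed.

Lemma wedgeDl (a b c : 'cV[C]_m) : wedge (a + b) c = wedge a c + wedge b c.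
Proof. by rewrite /wedge linearD mulmxDl mulmxDr; mxring. Qed.

Lemma wedgeZl f (a c : 'cV[C]_m) : wedge (f *: a) c = f *: wedge a c.
Proof. by rewrite /wedge linearZ -scalemxAl -scalemxAr; mxring. Qed.

Lemma wedgeC (a c : 'cV[C]_m) : wedge c a = - wedge a c.
Proof. by rewrite /wedge; mxring. Qed.

(** The term [p *: u] of [Iop], with [p = Di <u, h>], drops out of
    [wedge (Iop h) u], and integration by parts moves the remaining derivative
    from [h] to [u].  Stated for all degrees below [k] because heredity applies
    [Rop] to quadratic expressions. *)
Lemma Rop_factor d u h : (0 < d < k)%N -> mgrade 0 u -> mgrade d h ->
  apply_op (@Rop m) u h = apply_op (@Hop m) u (apply_op (@Iop m) u h).
Proof.
move=> dk Hu Hh; rewrite (HopE dk) //; last exact: mgrade_Iop.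
have Hu' := mgrade_Dx Hu; have Hh' := mgrade_Dx Hh.
have Huh : grade d (dot u h) by apply: grade_dot Hu Hh _.
have W a b : mgrade d a -> mgrade 0 b -> mgrade d (wedge a b).
  by move=> Ha Hb; apply: (mgrade_wedge Ha Hb); rewrite addn0.
rewrite /apply_op /Rop (@sum_Jmx_Di d) //; last exact: W.
have -> : map_mx Di (wedge (Iop D Di u h) u)
    = wedge h u - map_mx Di (wedge h (map_mx D u)).
  have -> : wedge (Iop D Di u h) u
      = map_mx D (wedge h u) - wedge h (map_mx D u).
    by rewrite /Iop wedgeDl wedgeZl mxD_wedge /wedge subrr scaler0; mxring.
  rewrite (mxDiD dk) ?(mxDiN dk) ?(mxDK dk) //; try exact: W.
    by apply/mgrade_Dx/W.
  by apply/mgradeN/W.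
rewrite /Iop map_mxD mxDZ (Dx_invK dk) // mulmxBl wedgeMl (dotC h u).
mxring.
Qed.

Lemma frechet_Iop u P Q : (1 < k)%N ->
  frechet (@Iop m) u P Q = Di (dot P Q) *: u + Di (dot u Q) *: P.
Proof.
move=> k1; rewrite /frechet /Iop -!/(vpencil _ _) -/(slope _) slopeD.
rewrite vpencil0 map_vpencil ?raddf0 // slope_vpencil ?map_mx0 add0r.
rewrite -vpencil0 dot_vpencil map_pencil ?Di0 // slopeZ addrC //.
Qed.

Lemma frechet_Hop d e u P Q : (0 < e)%N -> (d + e < k)%N ->
  mgrade 0 u -> mgrade d P -> mgrade e Q ->
  frechet (@Hop m) u P Q =
    map_mx Di (wedge Q P) *m u + map_mx Di (wedge Q u) *m P.
Proof.
move=> e0 dek Hu HP HQ.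
have ek : (0 < e < k)%N by rewrite e0 (leq_ltn_trans _ dek) // leq_addl.
have dk : (0 < d + e < k)%N by rewrite ltn_addl.
have k1 : (1 < k)%N by case/andP: ek; apply: leq_ltn_trans.
rewrite -(sum_Jmx_Di _ dk); last by apply: (mgrade_wedge HQ HP); rewrite addnC.
rewrite -(sum_Jmx_Di _ ek); last by apply: (mgrade_wedge HQ Hu); rewrite addn0.
rewrite /frechet /Hop -!/(vpencil _ _) -/(slope _) slopeD.
rewrite {1}vpencil0 map_vpencil ?raddf0 // slope_vpencil ?map_mx0 add0r.
rewrite slope_sum -big_split; apply: eq_bigr => i _ /=.
rewrite slope_sum -big_split; apply: eq_bigr => j _ /=.
by rewrite Jmx_vpencil dot_vpencil map_pencil ?Di0 // slopeZ addrC.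
Qed.

Lemma frechet_Rop d e u P Q : (0 < e)%N -> (d + e < k)%N ->
  mgrade 0 u -> mgrade d P -> mgrade e Q ->
  frechet (@Rop m) u P Q =
    (dot u P *+ 2) *: Q + Di (dot P Q) *: map_mx D u + Di (dot u Q) *: map_mx D P
    - (map_mx Di (wedge Q (map_mx D P)) *m u
       + map_mx Di (wedge Q (map_mx D u)) *m P).
Proof.
move=> e0 dek Hu HP HQ.
have ek : (0 < e < k)%N by rewrite e0 (leq_ltn_trans _ dek) // leq_addl.
have dk : (0 < d + e < k)%N by rewrite ltn_addl.
have k1 : (1 < k)%N by case/andP: ek; apply: leq_ltn_trans.
have Hu' := mgrade_Dx Hu; have HP' := mgrade_Dx HP.
rewrite -(sum_Jmx_Di _ dk); last by apply: (mgrade_wedge HQ HP'); rewrite addnC.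
rewrite -(sum_Jmx_Di _ ek); last by apply: (mgrade_wedge HQ Hu'); rewrite addn0.
rewrite /frechet /Rop -!/(vpencil _ _) -/(slope _) !slopeD slopeN slope_sum.
have -> : slope (map_mx (map_poly D) (map_mx (map_poly D) (map_mx polyC Q))) = 0.
  by rewrite vpencil0 !map_vpencil ?raddf0 // slope_vpencil ?map_mx0.
rewrite add0r -[X in _ = X - _]addrA; congr (_ + _ - _).
- apply/matrixP => i j; rewrite ord1 slopeE !scalemxE mapmxE.
  by rewrite coefMC coef1_dot_vpencil.
- by rewrite dot_vpencil map_pencil ?Di0 // map_vpencil ?raddf0 // slopeZ [LHS]addrC.
- rewrite -big_split; apply: eq_bigr => i _ /=.
  rewrite slope_sum -big_split; apply: eq_bigr => j _ /=.
  by rewrite map_vpencil ?raddf0 // !Jmx_vpencil dot_vpencil map_pencil ?Di0 // slopeZ addrC.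
Qed.

End Ops.
End Calculus.

(** * The symplectic and the cosymplectic operator *)

Local Ltac wedgering :=
  apply/matrixP => ? ?; rewrite !(wedgeE, addmxE, oppmxE, scalemxE, zeromxE); ring.

(** Antisymmetric matrices act on exterior products as derivations. *)
Lemma comm_wedge (B : comNzRingType) m (A : 'M[B]_m) (a b : 'cV[B]_m) :
  A^T = - A ->
  A *m wedge a b - wedge a b *m A = wedge (A *m a) b + wedge a (A *m b).
Proof.
move=> At; rewrite /wedge mulmxBr mulmxBl !trmx_mul At !mulmxN -!mulmxA.
mxring.
Qed.

Lemma tr_wedge (B : comNzRingType) m (A : 'M[B]_m) (a b : 'cV[B]_m) :
  A^T = - A -> \tr (A *m wedge a b) = dot b (A *m a) *+ 2.
Proof.
move=> At; have tr_outer (x y : 'cV[B]_m) : \tr (x *m y^T) = dot y x.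
  by rewrite mxtrace_mulC /mxtrace big_ord1 mxE; apply: eq_bigr => i _; rewrite mxE.
rewrite /wedge mulmxBr !mulmxA raddfB /= !tr_outer (dotC a) dot_mulmxl At.
by rewrite mulNmx dotNr opprK mulr2n.
Qed.

(** The trace form on matrices is invariant under commutators, so the trilinear
    form [tr ([A, B] C)] can be differentiated one factor at a time. *)
Lemma tr_comm_derivation (B : comNzRingType) m (X Y Z X' Y' Z' : 'M[B]_m) :
  \tr ((X' *m Y + X *m Y' - (Y' *m X + Y *m X')) *m Z + (X *m Y - Y *m X) *m Z')
  = \tr ((Y *m Z - Z *m Y) *m X') + \tr ((Z *m X - X *m Z) *m Y')
    + \tr ((X *m Y - Y *m X) *m Z').
Proof.
rewrite raddfD /=; congr (_ + _).
rewrite !(mulmxDl, mulNmx) !(raddfD, raddfN) /=.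
rewrite -(mulmxA X') (mxtrace_mulC X') -(mulmxA Y' X) (mxtrace_mulC Y').
rewrite (mxtrace_mulC (Y *m X')) (mxtrace_mulC (X *m Y')) !mulmxA.
ring.
Qed.

(** The algebra of the Jacobi identity, with [d_a] for the derivative of [x_a] and
    [W_a] for [Di (wedge x_a u)].  The left side is what remains of the cyclic
    sum after an integration by parts; the first three terms on the right are the
    derivatives of [<x2, W1 x3>], [<x3, W2 x1>] and [<x1, W3 x2>], the last three
    make up the derivative of half the trace of [[W1, W2] W3]. *)
Lemma jacobi_Hop (B : comNzRingType) m (u x1 x2 x3 d1 d2 d3 : 'cV[B]_m)
    (W1 W2 W3 : 'M[B]_m) :
  W1^T = - W1 -> W2^T = - W2 -> W3^T = - W3 ->
  dot (d2 + W2 *m u) (W1 *m x3) + dot x1 (W3 *m (d2 + W2 *m u))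
  + (dot (d3 + W3 *m u) (W2 *m x1) + dot x2 (W1 *m (d3 + W3 *m u)))
  + (dot (d1 + W1 *m u) (W3 *m x2) + dot x3 (W2 *m (d1 + W1 *m u)))
  = dot d2 (W1 *m x3) + dot x2 (wedge x1 u *m x3 + W1 *m d3)
  + (dot d3 (W2 *m x1) + dot x3 (wedge x2 u *m x1 + W2 *m d1))
  + (dot d1 (W3 *m x2) + dot x1 (wedge x3 u *m x2 + W3 *m d2))
  + (dot u ((W2 *m W3 - W3 *m W2) *m x1)
    + dot u ((W3 *m W1 - W1 *m W3) *m x2)
    + dot u ((W1 *m W2 - W2 *m W1) *m x3)).
Proof.
move=> T1 T2 T3.
have anti (W : 'M[B]_m) (x y : 'cV[B]_m) : W^T = - W -> dot x (W *m y) = - dot y (W *m x).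
  by move=> T; rewrite dotC dot_mulmxl T mulNmx dotNr.
rewrite !wedgeMl !mulmxDr !mulmxBl -!mulmxA !dotDl !dotDr !dotNr !dotZr.
rewrite !dot_mulmxl T1 T2 T3 !mulNmx !dotNr.
rewrite (anti W1 x2 (W3 *m u)) // (anti W2 x3 (W1 *m u)) // (anti W3 x1 (W2 *m u)) //.
rewrite !dot_mulmxl T1 T2 T3 !mulNmx !dotNr.
rewrite (dotC x1 u) (dotC x2 u) (dotC x3 u) (dotC x2 x1) (dotC x3 x2).
ring.
Qed.

Section Theorems.
Local Notation D := (Dx _).
Local Notation Di := (@Dx_inv _ _ _).
Variables (R : realType) (m : nat).

Theorem factorizes_Rop : factorizes R (@Rop m) (@Hop m) (@Iop m).
Proof. by move=> C u h /vgradeP Hu /vgradeP Hh; apply: (@Rop_factor _ _ _ _ 1). Qed.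

(** Every inner product containing [u], and every one of two test functions in the
    trilinear identity, is the derivative of its own [Di]; the Leibniz rule for
    products of these integrals, and for [<P, Q>], gives the primitives. *)
Theorem symplectic_Iop : symplectic R (@Iop m).
Proof.
split=> [C u P Q /vgradeP Hu /vgradeP HP /vgradeP HQ|].
  have HuP := grade_dot Hu HP (add0n 1); have HuQ := grade_dot Hu HQ (add0n 1).
  exists (dot P Q + Di (dot u P) * Di (dot u Q)).
    apply: gradeD; first exact: grade_dot HP HQ _.
    by apply: (@grade_mul _ _ _ 1 1); apply: grade_Dx_inv.
  rewrite !IopE raddfD /= D_dot Dx_leibniz !(@Dx_invK _ _ _ 1) //.
  by rewrite !(dotDl, dotDr, dotZl, dotZr) (dotC P u); ring.
move=> C u h1 h2 h3 /vgradeP Hu /vgradeP H1 /vgradeP H2 /vgradeP H3.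
have Hq (h : 'cV[C]_m) : mgrade 1 h -> grade 1 (dot u h) by move=> Hh; apply: grade_dot Hu Hh _.
have Hs (g h : 'cV[C]_m) : mgrade 1 g -> mgrade 1 h -> grade 2 (dot g h).
  by move=> Hg Hh; apply: grade_dot Hg Hh _.
exists (Di (dot u h2) * Di (dot h3 h1) + Di (dot u h3) * Di (dot h1 h2)
        + Di (dot u h1) * Di (dot h2 h3)).
  by apply: gradeD; [apply: gradeD|]; apply: (@grade_mul _ _ _ 1 2);
    apply: grade_Dx_inv => //; auto.
have Dq (h : 'cV[C]_m) : mgrade 1 h -> D (Di (dot u h)) = dot u h.
  by move=> Hh; apply: (@Dx_invK _ _ _ 1) => //; apply: Hq.
have Ds (g h : 'cV[C]_m) : mgrade 1 g -> mgrade 1 h -> D (Di (dot g h)) = dot g h.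
  by move=> Hg Hh; apply: (@Dx_invK _ _ _ 2) => //; apply: Hs.
rewrite !raddfD /= !Dx_leibniz !Dq // !Ds //.
rewrite !frechet_Iop // !dotDl !dotZl (dotC h3 h1) (dotC h3 h2) (dotC h2 h1).
ring.
Qed.

Lemma tr_Di_wedge k (C : nonlocal_calculus R k) d (a b : 'cV[C]_m) :
  (0 < d < k)%N -> mgrade d (wedge a b) ->
  (map_mx Di (wedge a b))^T = - map_mx Di (wedge a b).
Proof.
move=> dk H; rewrite -(mxDiN dk) //; apply/matrixP => i j.
by rewrite [LHS]mxE !mapmxE ?oppmxE wedge_antisym.
Qed.

Lemma halfMn2 (C : comAlgType R) (f : C) : (2^-1 : R) *: (f *+ 2) = f.
Proof.
have -> : f *+ 2 = (2%:R : R) *: f by rewrite scaler_nat.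
by rewrite scalerA mulVf ?pnatr_eq0 // scale1r. Qed.

(** Skew-adjointness is the Leibniz rule for
    [<P, Q> + sum Di <J_ij u, P> Di <J_ij u, Q>].  In the Jacobi identity the
    variation of [Hop] produces [U x y = Di (wedge x (Hop y))] of degree two;
    pairing with [W x = Di (wedge x u)] under the trace and integrating by parts
    removes it, after which [jacobi_Hop] applies. *)
Theorem cosymplectic_Hop : cosymplectic R (@Hop m).
Proof.
split=> [C u P Q /vgradeP Hu /vgradeP HP /vgradeP HQ|].
  have HJ i j (h : 'cV[C]_m) : mgrade 1 h -> grade 1 (dot (Jmx C i j *m u) h).
    move=> Hh; rewrite dot_Jmx; exact: (mgrade_wedge Hh Hu (addn0 1)).
  exists (dot P Q + \sum_(i < m) \sum_(j < m | (i < j)%N)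
     Di (dot (Jmx C i j *m u) P) * Di (dot (Jmx C i j *m u) Q)).
    apply: gradeD; first exact: grade_dot HP HQ _.
    apply: grade_sum => i _; apply: grade_sum => j _.
    by apply: (@grade_mul _ _ _ 1 1); apply: grade_Dx_inv => //; apply: HJ.
  rewrite raddfD /= D_dot /apply_op /Hop dotDl dotDr dot_suml dot_sumr.
  rewrite addrACA; congr (_ + _); rewrite raddf_sum -big_split; apply: eq_bigr => i _ /=.
  rewrite dot_suml dot_sumr raddf_sum -big_split; apply: eq_bigr => j _ /=.
  rewrite Dx_leibniz !(@Dx_invK _ _ _ 1) //; try exact: HJ.
  by rewrite dotZl dotZr (dotC P); ring.
move=> C u x1 x2 x3 /vgradeP Hu /vgradeP H1 /vgradeP H2 /vgradeP H3.
have dk1 : (0 < 1 < 3)%N by [].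
have dk2 : (0 < 2 < 3)%N by [].
pose W x := map_mx (@Dx_inv _ _ C) (wedge x u).
have Hwu x : mgrade 1 x -> mgrade 1 (wedge x u).
  by move=> Hx; apply: (mgrade_wedge Hx Hu (addn0 1)).
have HW x : mgrade 1 x -> mgrade 1 (W x) by move=> Hx; apply/mgrade_Di/Hwu.
have WT x : mgrade 1 x -> (W x)^T = - W x.
  by move=> Hx; apply: (tr_Di_wedge dk1); apply: Hwu.
have DW x : mgrade 1 x -> map_mx D (W x) = wedge x u.
  by move=> Hx; apply: (mxDiK dk1); apply: Hwu.
pose p x := map_mx (Dx C) x + W x *m u.
have Hp x : mgrade 1 x -> mgrade 1 (p x).
  move=> Hx; apply: mgradeD; first exact: mgrade_Dx.
  exact: mgradeM (HW x Hx) Hu (addn0 1).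
have HopE' x : mgrade 1 x -> apply_op (@Hop m) u x = p x by move=> Hx; apply: (HopE dk1).
pose U x y := map_mx (@Dx_inv _ _ C) (wedge x (p y)).
have HU x y : mgrade 1 x -> mgrade 1 y -> mgrade 2 (wedge x (p y)).
  by move=> Hx Hy; apply: (mgrade_wedge Hx (Hp y Hy)).
(* For antisymmetric matrices the trace form is, up to the factor -2, the sum of
   products of entries with [i < j]; this is where the halves below come from. *)
pose g x y z := \tr (U z y *m W x).
have Dg x y z : mgrade 1 x -> mgrade 1 y -> mgrade 1 z ->
    D (g x y z) = (dot (p y) (W x *m z) - dot x (U z y *m u)) *+ 2.
  move=> Hx Hy Hz; rewrite D_mxtrace mxDM raddfD /= DW // (mxDiK dk2); last exact: HU.
  rewrite (mxtrace_mulC (wedge z _)) tr_wedge; last exact: WT.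
  rewrite wedgeC mulmxN raddfN /= tr_wedge; last by apply: (tr_Di_wedge dk2); apply: HU.
  by rewrite mulrnBl.
pose t x y z := \tr ((W x *m W y - W y *m W x) *m W z).
have br x y : mgrade 1 x -> mgrade 1 y ->
    (W x *m W y - W y *m W x)^T = - (W x *m W y - W y *m W x).
  move=> Hx Hy; rewrite linearB /= !trmx_mul !WT // !mulNmx !mulmxN !opprK opprB //.
have Dt : D (t x1 x2 x3) = (dot u ((W x2 *m W x3 - W x3 *m W x2) *m x1)
    + dot u ((W x3 *m W x1 - W x1 *m W x3) *m x2)
    + dot u ((W x1 *m W x2 - W x2 *m W x1) *m x3)) *+ 2.
  rewrite D_mxtrace mxDM map_mxB !mxDM !DW // !mulrnDl -!tr_wedge; try exact: br.
  by rewrite -tr_comm_derivation.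
have frH x y : mgrade 1 x -> mgrade 1 y ->
    frechet (@Hop m) u (p y) x = U x y *m u + W x *m p y.
  by move=> Hx Hy; apply: (@frechet_Hop _ _ _ _ 1 1) => //; apply: Hp.
have grg x y z : mgrade 1 x -> mgrade 1 y -> mgrade 1 z -> grade 3 (g x y z).
  move=> Hx Hy Hz; apply/grade_tr/(mgradeM _ (HW x Hx) (erefl (2 + 1)%N)).
  by apply: mgrade_Di => //; apply: HU.
have grt : grade 3 (t x1 x2 x3).
  apply/grade_tr/(mgradeM _ (HW x3 H3) (erefl (2 + 1)%N)).
  by apply: mgradeB; apply: (mgradeM (HW _ _) (HW _ _)).
have pE x : p x = map_mx (Dx C) x + W x *m u by [].
(* Only the derivatives and degrees recorded above are used from here on. *)
clearbody g t p U W.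
have Et := congr1 (fun f => (2^-1 : R) *: f) Dt.
rewrite halfMn2 -linearZ in Et.
have Eg : D ((2^-1 : R) *: (g x1 x2 x3 + g x2 x3 x1 + g x3 x1 x2))
    = dot (p x2) (W x1 *m x3) - dot x1 (U x3 x2 *m u)
    + (dot (p x3) (W x2 *m x1) - dot x2 (U x1 x3 *m u))
    + (dot (p x1) (W x3 *m x2) - dot x3 (U x2 x1 *m u)).
  by rewrite linearZ /= !raddfD /= !Dg // !halfMn2.
exists (dot x2 (W x1 *m x3) + dot x3 (W x2 *m x1) + dot x1 (W x3 *m x2)
    + ((2^-1 : R) *: t x1 x2 x3
    - (2^-1 : R) *: (g x1 x2 x3 + g x2 x3 x1 + g x3 x1 x2))).
  have grW x y z : mgrade 1 x -> mgrade 1 y -> mgrade 1 z ->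
      grade 3 (dot x (W y *m z)).
    by move=> Hx Hy Hz; apply: (grade_dot Hx (mgradeM (HW y Hy) Hz erefl)).
  apply: gradeD; first by apply: gradeD; [apply: gradeD|]; apply: grW.
  apply: gradeD; [exact: gradeZ|apply/gradeN/gradeZ].
  by apply: gradeD; [apply: gradeD|]; apply: grg.
rewrite [RHS]raddfD /= raddfB /= Et Eg !raddfD /=.
rewrite !HopE' // !frH // !D_dot !mxDM !DW //.
have := @jacobi_Hop C m u x1 x2 x3 (map_mx D x1) (map_mx D x2) (map_mx D x3)
  (W x1) (W x2) (W x3) (WT x1 H1) (WT x2 H2) (WT x3 H3).
rewrite -!pE !(dotDr x1 (_ *m u)) !(dotDr x2 (_ *m u)) !(dotDr x3 (_ *m u)).
move=> /eqP; rewrite -subr_eq0 => /eqP E; apply: subr0_eq; rewrite -[RHS]E.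
ring.
Qed.

End Theorems.

(** * Heredity *)

Section Hereditary.
Variables (R : realType) (m : nat).
Local Notation D := (Dx _).
Local Notation Di := (@Dx_inv _ _ _).

(** The rotation of the normal frame under the flow [u_t = Rop h]: the block of
    the connection form between two normal vectors.  Although [map_mx D h] occurs
    instead of [Iop h], the two differ by a multiple of [u]. *)
Definition normal_rotation k (C : nonlocal_calculus R k) (u h : 'cV[C]_m) : 'M[C]_m :=
  map_mx Di (wedge (map_mx D h) u).

(** The form in which [Rop] enters the zero-curvature representation. *)
Lemma Rop_rotation k (C : nonlocal_calculus R k) d (u h : 'cV[C]_m) :
  (0 < d < k)%N -> mgrade 0 u -> mgrade d h ->
  apply_op (@Rop m) u h =
    map_mx D (apply_op (@Iop m) u h) + normal_rotation u h *m u.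
Proof.
move=> dk Hu Hh; rewrite (Rop_factor dk) // (HopE dk) //; last exact: mgrade_Iop.
rewrite IopE /normal_rotation wedgeDl wedgeZl; congr (_ + map_mx _ _ *m _).
by rewrite [wedge u u]/wedge subrr scaler0 addr0.
Qed.

Lemma Di_wedge_parts k (C : nonlocal_calculus R k) d (a b : 'cV[C]_m) :
  (0 < d < k)%N -> mgrade d (wedge a b) ->
  mgrade d (wedge (map_mx D a) b) ->
  map_mx Di (wedge a (map_mx D b)) = wedge a b - map_mx Di (wedge (map_mx D a) b).
Proof.
move=> dk H H'.
have -> : wedge a (map_mx D b) = map_mx D (wedge a b) - wedge (map_mx D a) b.
  by rewrite mxD_wedge; mxring.
rewrite (mxDiD dk) ?(mxDiN dk) ?(mxDK dk) //; first exact: mgrade_Dx.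
exact: mgradeN.
Qed.

(** The variation of [h |-> D (Iop h) + Di (wedge (map_mx D h) u) u] in its
    occurrences of [u]; the defining expression of [Rop] is brought to this form by
    integrating by parts. *)
Lemma frechet_Rop_rotation k (C : nonlocal_calculus R k) d e (u P Q : 'cV[C]_m) :
  (0 < e)%N -> (d + e < k)%N -> mgrade 0 u -> mgrade d P -> mgrade e Q ->
  frechet (@Rop m) u P Q =
    map_mx D (Di (dot P Q) *: u + Di (dot u Q) *: P)
    + normal_rotation u Q *m P + map_mx Di (wedge (map_mx D Q) P) *m u.
Proof.
move=> e0 dek Hu HP HQ.
have ek : (0 < e < k)%N by rewrite e0 (leq_ltn_trans _ dek) // leq_addl.
have dk : (0 < d + e < k)%N by rewrite ltn_addl.
have HQ' := mgrade_Dx HQ.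
rewrite (frechet_Rop e0 dek Hu HP HQ) (Di_wedge_parts dk); last 2 first.
- by apply: (mgrade_wedge HQ HP); rewrite addnC.
- by apply: (mgrade_wedge HQ' HP); rewrite addnC.
rewrite (Di_wedge_parts ek); last 2 first.
- by apply: (mgrade_wedge HQ Hu); rewrite addn0.
- by apply: (mgrade_wedge HQ' Hu); rewrite addn0.
rewrite map_mxD !mxDZ (Dx_invK dk); last exact: grade_dot HP HQ _.
rewrite (Dx_invK ek); last exact: grade_dot Hu HQ _.
rewrite /normal_rotation !(mulmxBl (wedge _ _)) !wedgeMl (dotC u P) (dotC Q u) (dotC Q P).
mxring.
Qed.

Lemma Iop_add k (C : nonlocal_calculus R k) d (u h h' : 'cV[C]_m) :
  (0 < d < k)%N -> mgrade 0 u -> mgrade d h -> mgrade d h' ->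
  apply_op (@Iop m) u (h + h') = apply_op (@Iop m) u h + apply_op (@Iop m) u h'.
Proof.
move=> dk Hu Hh Hh'; rewrite !IopE map_mxD.
have -> : Di (dot u (h + h')) = Di (dot u h) + Di (dot u h').
  have G x : mgrade d x -> grade d (dot u x) by move=> Hx; apply: grade_dot Hu Hx _.
  apply: (Dx_inj dk).
  - exact/grade_Dx_inv/G/mgradeD.
  - by apply: gradeD; apply/grade_Dx_inv/G.
  - rewrite raddfD /= !(Dx_invK dk) ?dotDr //; try exact: G.
    by rewrite -dotDr; apply/G/mgradeD.
mxring.
Qed.

Lemma mgrade_rotation k (C : nonlocal_calculus R k) d (u h : 'cV[C]_m) :
  (0 < d < k)%N -> mgrade 0 u -> mgrade d h -> mgrade d (normal_rotation u h).
Proof.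
move=> dk Hu Hh; apply: mgrade_Di => //.
by apply: (mgrade_wedge (mgrade_Dx Hh) Hu); rewrite addn0.
Qed.

Lemma Rop_add k (C : nonlocal_calculus R k) d (u h h' : 'cV[C]_m) :
  (0 < d < k)%N -> mgrade 0 u -> mgrade d h -> mgrade d h' ->
  apply_op (@Rop m) u (h + h') = apply_op (@Rop m) u h + apply_op (@Rop m) u h'.
Proof.
move=> dk Hu Hh Hh'; rewrite !(Rop_rotation dk) //; last exact: mgradeD.
have G x : mgrade d x -> mgrade d (wedge (map_mx D x) u).
  by move=> Hx; apply: (mgrade_wedge (mgrade_Dx Hx) Hu); rewrite addn0.
rewrite (Iop_add dk) // /normal_rotation !map_mxD wedgeDl (mxDiD dk); try exact: G.
by rewrite mulmxDl; mxring.
Qed.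

Lemma mgrade_frechet_Rop k (C : nonlocal_calculus R k) d e (u P Q : 'cV[C]_m) :
  (0 < e)%N -> (d + e < k)%N -> mgrade 0 u -> mgrade d P -> mgrade e Q ->
  mgrade (d + e) (frechet (@Rop m) u P Q).
Proof.
move=> e0 dek Hu HP HQ.
have ek : (0 < e < k)%N by rewrite e0 (leq_ltn_trans _ dek) // leq_addl.
have dk : (0 < d + e < k)%N by rewrite ltn_addl.
rewrite (frechet_Rop_rotation e0 dek Hu HP HQ); apply: mgradeD; first apply: mgradeD.
- apply/mgrade_Dx/mgradeD.
    by apply: mgradeZ (grade_Dx_inv dk (grade_dot HP HQ erefl)) Hu (addn0 _).
  by apply: mgradeZ (grade_Dx_inv ek (grade_dot Hu HQ erefl)) HP (addnC _ _).
- exact: mgradeM (mgrade_rotation ek Hu HQ) HP (addnC _ _).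
- apply: mgradeM (mgrade_Di dk _) Hu (addn0 _).
  exact: mgrade_wedge (mgrade_Dx HQ) HP (addnC _ _).
Qed.



(** With [S = Rop P], [T = Rop Q] and [V = normal_rotation u], the difference of
    the two sides is [Rop beta] minus the right side of [frST], where [beta]
    contains only integrals of degree one because those of degree two in
    [Rop'[P] Q - Rop'[Q] P] cancel or combine to local terms.  The identities [cE],
    [YE] and [XE] compute [Di <u, beta>], [Iop beta] and [V beta], the entries of
    the zero-curvature matrix of [beta]. *)
Theorem hereditary_Rop : hereditary R (@Rop m).
Proof.
move=> C u P Q /vgradeP Hu /vgradeP HP /vgradeP HQ.
have dk1 : (0 < 1 < 3)%N by [].
have dk2 : (0 < 2 < 3)%N by [].
have l01 : (0 < 1)%N by [].
have l23 : (1 + 1 < 3)%N by [].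
have HP' := mgrade_Dx HP; have HQ' := mgrade_Dx HQ.
pose p := Di (dot u P); pose q := Di (dot u Q).
have Hp : grade 1 p by apply/grade_Dx_inv/(grade_dot Hu HP (add0n 1)).
have Hq : grade 1 q by apply/grade_Dx_inv/(grade_dot Hu HQ (add0n 1)).
have Dp : D p = dot u P by apply/(Dx_invK dk1)/(grade_dot Hu HP (add0n 1)).
have Dq : D q = dot u Q by apply/(Dx_invK dk1)/(grade_dot Hu HQ (add0n 1)).
pose V h := normal_rotation u h.
have HVP : mgrade 1 (V P) by apply: mgrade_rotation.
have HVQ : mgrade 1 (V Q) by apply: mgrade_rotation.
have Hwu x : mgrade 1 x -> mgrade 1 (wedge x u).
  by move=> Hx; apply: (mgrade_wedge Hx Hu (addn0 1)).
have VPT : (V P)^T = - V P by apply/(tr_Di_wedge dk1)/Hwu.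
have VQT : (V Q)^T = - V Q by apply/(tr_Di_wedge dk1)/Hwu.
have DVP : map_mx D (V P) = wedge (map_mx D P) u by apply/(mxDiK dk1)/Hwu.
have DVQ : map_mx D (V Q) = wedge (map_mx D Q) u by apply/(mxDiK dk1)/Hwu.
pose I h := apply_op (@Iop m) u h.
have HIP : mgrade 1 (I P) by apply: mgrade_Iop.
have HIQ : mgrade 1 (I Q) by apply: mgrade_Iop.
have P'E : map_mx D P = I P - p *: u by rewrite /I IopE addrK.
have Q'E : map_mx D Q = I Q - q *: u by rewrite /I IopE addrK.
pose S := apply_op (@Rop m) u P; pose T := apply_op (@Rop m) u Q.
have SE : S = map_mx D (I P) + V P *m u by apply: (Rop_rotation dk1).
have TE : T = map_mx D (I Q) + V Q *m u by apply: (Rop_rotation dk1).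
have HS : mgrade 1 S.
  rewrite SE; apply: mgradeD; first exact: mgrade_Dx.
  exact: mgradeM HVP Hu (addn0 1).
have HT : mgrade 1 T.
  rewrite TE; apply: mgradeD; first exact: mgrade_Dx.
  exact: mgradeM HVQ Hu (addn0 1).
pose a := Di (dot S Q); pose b := Di (dot T P).
have Ha : grade 2 a by apply/grade_Dx_inv/(grade_dot HS HQ erefl).
have Hb : grade 2 b by apply/grade_Dx_inv/(grade_dot HT HP erefl).
have Da : D a = dot S Q by apply/(Dx_invK dk2)/(grade_dot HS HQ erefl).
have Db : D b = dot T P by apply/(Dx_invK dk2)/(grade_dot HT HP erefl).
pose E := map_mx (@Dx_inv _ _ C) (wedge (map_mx D Q) S).
pose F := map_mx (@Dx_inv _ _ C) (wedge (map_mx D P) T).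
have HE : mgrade 2 E by apply/mgrade_Di/(mgrade_wedge HQ' HS erefl).
have HF : mgrade 2 F by apply/mgrade_Di/(mgrade_wedge HP' HT erefl).
have DE : map_mx D E = wedge (map_mx D Q) S by apply/(mxDiK dk2)/(mgrade_wedge HQ' HS erefl).
have DF : map_mx D F = wedge (map_mx D P) T by apply/(mxDiK dk2)/(mgrade_wedge HP' HT erefl).
pose beta := q *: map_mx D P - p *: map_mx D Q + (V Q *m P - V P *m Q).
have Hbeta : mgrade 2 beta.
  apply: mgradeD; apply: mgradeB.
  - exact: mgradeZ Hq HP' erefl.
  - exact: mgradeZ Hp HQ' erefl.
  - exact: mgradeM HVQ HP erefl.
  - exact: mgradeM HVP HQ erefl.
(* The integrals of degree two combine into [wedge Q P], by parts. *)
have fr12 : frechet (@Rop m) u P Q = frechet (@Rop m) u Q P + beta.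
  rewrite (frechet_Rop_rotation l01 l23 Hu HP HQ) (frechet_Rop_rotation l01 l23 Hu HQ HP).
  have -> : map_mx Di (wedge (map_mx D Q) P)
          = wedge Q P + map_mx Di (wedge (map_mx D P) Q).
    rewrite wedgeC (mxDiN dk2); last exact: (mgrade_wedge HP HQ' erefl).
    rewrite (Di_wedge_parts dk2); last 2 first.
    - exact: (mgrade_wedge HP HQ erefl).
    - exact: (mgrade_wedge HP' HQ erefl).
    by rewrite [wedge Q P]wedgeC; mxring.
  rewrite -/p -/q -!/(V _) !map_mxD !mxDZ Dp Dq (dotC Q P) !(mulmxDl (wedge _ _)) wedgeMl.
  by rewrite (dotC P u) (dotC Q u) /beta; mxring.
have frST : frechet (@Rop m) u S Q - frechet (@Rop m) u T P =
    map_mx D ((a - b) *: u + q *: S - p *: T) + (V Q *m S - V P *m T) + (E - F) *m u.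
  rewrite (frechet_Rop_rotation l01 l23 Hu HS HQ) (frechet_Rop_rotation l01 l23 Hu HT HP).
  rewrite -/p -/q -/a -/b -!/(V _) -/E -/F mulmxBl !map_mxD !map_mxN.
  by rewrite scalerBl map_mxB; mxring.
have R12 := Rop_add dk2 Hu (mgrade_frechet_Rop l01 l23 Hu HQ HP) Hbeta.
have Rb := Rop_rotation dk2 Hu Hbeta.
rewrite IopE in Rb.
suff key : apply_op (@Rop m) u beta = frechet (@Rop m) u S Q - frechet (@Rop m) u T P.
  by rewrite fr12 R12 key addrA addrAC addrK.
rewrite {}frST {}Rb => {R12 fr12}.
have Hrot : mgrade 2 (normal_rotation u beta) by apply: mgrade_rotation.
have Drot : map_mx D (normal_rotation u beta) = wedge (map_mx D beta) u.
  by apply/(mxDiK dk2)/(mgrade_wedge (mgrade_Dx Hbeta) Hu).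
have Hc : grade 2 (Di (dot u beta)) by apply/grade_Dx_inv/(grade_dot Hu Hbeta).
have Dc : D (Di (dot u beta)) = dot u beta by apply/(Dx_invK dk2)/(grade_dot Hu Hbeta).
have betaE : beta = q *: I P - p *: I Q + (V Q *m P - V P *m Q).
  by rewrite /beta P'E Q'E; mxring.
clearbody a b E F V I S T p q beta.
move: (normal_rotation u beta) (Di (dot u beta)) Hrot Drot Hc Dc => X c HX DX Hc Dc.
have anti h (x y : 'cV[C]_m) : (V h)^T = - V h -> dot (V h *m x) y = - dot x (V h *m y).
  by move=> Vh; rewrite dot_mulmxl Vh mulNmx dotNr.
have cE : c = a - b + (dot P (I Q) - dot Q (I P)).
  apply: (Dx_inj dk2) => //.
    apply: gradeD; apply: gradeD => //; try apply: gradeN => //.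
      exact: grade_dot HP HIQ erefl.
    exact: grade_dot HQ HIP erefl.
  rewrite Dc !raddfD !raddfN /= Da Db !D_dot P'E Q'E SE TE betaE.
  rewrite !(dotDl, dotDr, dotNl, dotNr, dotZl, dotZr) !anti //.
  rewrite (dotC Q (map_mx D (I P))) (dotC P (map_mx D (I Q))) (dotC (I Q)).
  ring.
have YE : map_mx D beta + c *: u =
    (a - b) *: u + q *: S - p *: T + (V Q *m I P - V P *m I Q).
  rewrite cE betaE !(map_mxD, map_mxN, mxDZ, mxDM) Dp Dq DVP DVQ !wedgeMl P'E Q'E SE TE.
  rewrite !(mulmxDr, mulmxN) -!scalemxAr !(dotDl, dotNl, dotZl).
  rewrite (dotC P) (dotC Q) .
  mxring.
have DbE : map_mx D beta =
    (a - b - c) *: u + q *: S - p *: T + (V Q *m I P - V P *m I Q).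
  by rewrite -[LHS](addrK (c *: u)) YE; mxring.
(* The last two terms form the normal block of the commutator of the infinitesimal
   rotations of the full frame that belong to [Q] and [P]. *)
have XE : X = E - F + (V Q *m V P - V P *m V Q) - wedge (I Q) (I P).
  apply: (mxDx_inj dk2) => //.
    apply: mgradeB; last exact: (mgrade_wedge HIQ HIP erefl).
    apply: mgradeD; apply: mgradeB => //.
      exact: mgradeM HVQ HVP erefl.
    exact: mgradeM HVP HVQ erefl.
  rewrite DX DbE !(mxD_wedge, map_mxD, map_mxN, mxDM) DE DF DVP DVQ.
  have -> : wedge (map_mx D Q) u *m V P + V Q *m wedge (map_mx D P) u
      - (wedge (map_mx D P) u *m V Q + V P *m wedge (map_mx D Q) u)
      = wedge (V Q *m map_mx D P) u + wedge (map_mx D P) (V Q *m u)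
      - (wedge (V P *m map_mx D Q) u + wedge (map_mx D Q) (V P *m u)).
    by rewrite -!comm_wedge //; mxring.
  rewrite SE TE P'E Q'E !(mulmxDr, mulmxN) -!scalemxAr.
  wedgering.
move: (wedge _ _) (wedgeMl (I Q) (I P) u) XE => W WE XE.
rewrite YE XE !(map_mxD, map_mxN, mxDM) DVP DVQ !wedgeMl !(mulmxDl _ _ u) !mulNmx WE.
rewrite SE TE P'E Q'E !(mulmxDr, mulmxN) !mulmxA !(dotDl, dotNl, dotZl).
rewrite (dotC (I Q) u) (dotC (I P) u) (dotC (I Q) (I P)).
mxring.
Qed.
End Hereditary.

(** * Symmetry of second derivatives *)

Section Smooth.
Variable R : realType.

(** Differentiability is a local property; the smoothness assumptions only
    concern open sets, outside of which the functions are arbitrary. *)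
Lemma near_eq_differentiable (V W : normedModType R) (f g : V -> W) x :
  (\near x, f x = g x) -> differentiable f x -> differentiable g x.
Proof.
move=> fg df.
have fgx : f x = g x by exact: (nbhs_singleton fg).
have [cd E] := (diff_locallyP x f).1 df.
have Eg : g \o shift x = cst (g x) + 'd f x +o_ 0 id.
  apply/eqaddoP => e e0.
  move/eqaddoP : E => /(_ e e0); apply: filter_app.
  have : \forall h \near 0, f (h + x) = g (h + x).
    move: fg; rewrite (near_shift 0); apply: filterS => h /=.
    by rewrite subr0.
  apply: filter_app; near=> h => E1 /=.
  by rewrite !fctE /= E1 fgx.
have dE := diff_unique cd Eg.
by apply/diff_locallyP; rewrite dE; split.
Unshelve. all: by end_near. Qed.

Lemma near_of_open (T : topologicalType) (U : set T) x (P : T -> Prop) :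
  open U -> U x -> (forall y, U y -> P y) -> \near x, P x.
Proof. by move=> oU Ux H; near=> y; apply: H; near: y; apply: open_nbhs_nbhs. 
Unshelve. all: by end_near. Qed.

Lemma Ck_ext (V W : normedModType R) k (U : set V) (f g : V -> W) :
  open U -> (forall x, U x -> f x = g x) -> Ck k U f -> Ck k U g.
Proof.
move=> oU; elim: k f g => [|k IH] f g fg /=.
  move=> cf x Ux; rewrite /prop_for /continuous_at -fg //.
  apply: cvg_trans (cf x Ux); apply: near_eq_cvg.
  exact: (near_of_open oU Ux).
move=> [df Df]; split=> [x Ux|v].
  by apply: (near_eq_differentiable _ (df x Ux)); apply: (near_of_open oU Ux).
apply: IH (Df v) => x Ux; apply: near_eq_derive; exact: (near_of_open oU Ux).
Qed.

Lemma Ck_coord (V : normedModType R) p q k (U : set V) (f : V -> 'M[R]_(p, q)) i j :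
  open U -> Ck k U f -> Ck k U (fun x => f x i j).
Proof.
move=> oU; elim: k f => [|k IH] f /=.
  move=> cf x Ux; apply: (@continuous_comp _ _ _ f (fun A : 'M[R]_(p, q) => A i j)).
    exact: cf.
  exact: coord_continuous.
move=> [df Df]; split=> [x Ux|v].
  apply: (@differentiable_comp _ _ _ _ f (fun A : 'M[R]_(p, q) => A i j)).
    exact: df.
  exact: differentiable_coord.
apply: (Ck_ext oU _ (IH _ (Df v))) => x Ux.
by rewrite (derive_mx (diff_derivable (df x Ux))) mxE.
Qed.

Lemma is_derive_line (V W : normedModType R) (f : V -> W) (v b : V) (c : R) :
  derivable f (c *: v + b) v ->
  is_derive c 1 (fun s => f (s *: v + b)) ('D_v f (c *: v + b)).
Proof.
have E : (fun h : R => h^-1 *: (((fun s => f (s *: v + b)) \o shift c) (h *: 1)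
            - f (c *: v + b)))
  = (fun h : R => h^-1 *: ((f \o shift (c *: v + b)) (h *: v) - f (c *: v + b))).
  by apply/funext => h /=; rewrite [h *: 1]mulr1 scalerDl addrA.
by move=> df; apply: DeriveDef; rewrite /derivable /derive E.
Qed.

(** The second difference of [f] over a square, as a value of the mixed derivative
    inside it: the mean value theorem in direction [v], then in direction [w]. *)
Lemma schwarz_mvt (V : normedModType R) (f : V -> R) (v w z : V) (d : R) :
  0 < d ->
  (forall s r, 0 <= s <= d -> 0 <= r <= d ->
     differentiable f (s *: v + (r *: w + z)) /\
     differentiable ('D_v f) (s *: v + (r *: w + z))) ->
  exists s r, [/\ 0 <= s <= d, 0 <= r <= d &
    f (d *: v + (d *: w + z)) - f (d *: v + z) - f (d *: w + z) + f z
    = d ^+ 2 * 'D_w ('D_v f) (s *: v + (r *: w + z))].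
Proof.
move=> d0 H.
have dd : 0 <= d <= d by rewrite lexx ltW.
have d00 : 0 <= (0 : R) <= d by rewrite lexx ltW.
have H0 s : 0 <= s <= d -> differentiable f (s *: v + z) /\ differentiable ('D_v f) (s *: v + z).
  by move=> sd; have := H s 0 sd d00; rewrite scale0r add0r.
pose phi s := f (s *: v + (d *: w + z)) - f (s *: v + z).
pose dphi s := 'D_v f (s *: v + (d *: w + z)) - 'D_v f (s *: v + z).
have phiD s : 0 <= s <= d -> is_derive s 1 phi (dphi s).
  move=> sd; apply: is_deriveB; apply: is_derive_line; apply: diff_derivable.
    by have [] := H s d sd dd.
  by have [] := H0 s sd.
have [||s sd Es] := @MVT _ phi dphi 0 d d0.
- by move=> s /andP[s0 sd]; apply: phiD; rewrite (ltW s0) (ltW sd).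
- apply: derivable_within_continuous => s; rewrite in_itv /= => sd.
  exact: (@ex_derive _ _ _ _ _ _ _ (phiD s sd)).
have {}sd : 0 <= s <= d by move: sd; rewrite in_itv /= => /andP[a b]; rewrite (ltW a) (ltW b).
pose psi r := 'D_v f (s *: v + (r *: w + z)).
have psiE : psi = (fun r => 'D_v f (r *: w + (s *: v + z))).
  by apply/funext => r; rewrite /psi addrCA.
have psiD r : 0 <= r <= d -> is_derive r 1 psi ('D_w ('D_v f) (s *: v + (r *: w + z))).
  move=> rd; rewrite psiE addrCA; apply: is_derive_line; apply: diff_derivable.
  by rewrite addrCA; have [] := H s r sd rd.
have [||r rd Er] := @MVT _ psi (fun r => 'D_w ('D_v f) (s *: v + (r *: w + z))) 0 d d0.
- by move=> r /andP[r0 rd]; apply: psiD; rewrite (ltW r0) (ltW rd).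
- apply: derivable_within_continuous => r; rewrite in_itv /= => rd.
  exact: (@ex_derive _ _ _ _ _ _ _ (psiD r rd)).
have {}rd : 0 <= r <= d by move: rd; rewrite in_itv /= => /andP[a b]; rewrite (ltW a) (ltW b).
exists s, r; split=> //.
move: Es Er; rewrite /phi /dphi /psi !scale0r !add0r !subr0 => Es Er.
rewrite Er in Es.
rewrite (_ : d ^+ 2 * _ = 'D_w ('D_v f) (s *: v + (r *: w + z)) * d * d); last by ring.
by rewrite -Es; ring.
Qed.

(** If two continuous functions take a common value, possibly at different points,
    in every small box at [z], then they agree at [z]. *)
Lemma limit_eq_of_boxes (V : normedModType R) (U : set V) (A B : V -> R) (v w z : V) :
  open U -> U z -> {for z, continuous A} -> {for z, continuous B} ->
  (forall d, 0 < d ->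
     (forall s r, 0 <= s <= d -> 0 <= r <= d -> U (s *: v + (r *: w + z))) ->
     exists s r s' r', [/\ 0 <= s <= d, 0 <= r <= d, 0 <= s' <= d, 0 <= r' <= d &
       A (s *: v + (r *: w + z)) = B (s' *: v + (r' *: w + z))]) ->
  A z = B z.
Proof.
move=> oU Uz cA cB H.
apply/eqP; rewrite -subr_eq0 -normr_le0; apply/ler_addgt0Pr => e e0; rewrite add0r.
have e2 : 0 < e / 2 by rewrite divr_gt0.
have nU : nbhs z U by apply: open_nbhs_nbhs.
have nA : nbhs z [set x | `|A z - A x| < e / 2] by have /cvgrPdist_lt := cA; apply.
have nB : nbhs z [set x | `|B z - B x| < e / 2] by have /cvgrPdist_lt := cB; apply.
have := filterI nU (filterI nA nB); rewrite nbhs_ballP => -[rho /= rho0 Hb].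
pose N : R := `|v| + `|w| + 1.
have N0 : 0 < N by rewrite ltr_wpDl // addr_ge0.
pose d := rho / (2 * N).
have d0 : 0 < d by rewrite divr_gt0 // mulr_gt0.
have inb s r : 0 <= s <= d -> 0 <= r <= d -> ball z rho (s *: v + (r *: w + z)).
  move=> /andP[s0 sd] /andP[r0 rd]; rewrite -ball_normE /= addrA distrC addrK.
  apply: le_lt_trans (ler_normD _ _) _; rewrite !normrZ !ger0_norm //.
  have : s * `|v| + r * `|w| <= d * `|v| + d * `|w| by rewrite lerD // ler_wpM2r.
  move/le_lt_trans; apply; rewrite -mulrDr.
  have -> : rho = d * (2 * N) by rewrite divfK // mulf_neq0 // gt_eqF.
  rewrite ltr_pM2l //; have := normr_ge0 v; have := normr_ge0 w; rewrite /N.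
  by move: `|v| `|w| => a b; lra.
have [|s [r [s' [r' [sd rd sd' rd' E]]]]] := H d d0.
  by move=> s r sd rd; have [] := Hb _ (inb s r sd rd).
have [_ [/= A1 _]] := Hb _ (inb s r sd rd).
have [_ [_ /= A2]] := Hb _ (inb s' r' sd' rd').
rewrite E in A1.
rewrite (le_trans (ler_distD (B (s' *: v + (r' *: w + z))) _ _)) // (distrC _ (B z)).
by rewrite [e]splitr lerD // ltW.
Qed.

(** The second difference is symmetric in the two directions, so by [schwarz_mvt]
    both mixed derivatives take a common value on every small box. *)
Lemma schwarz (V : normedModType R) (U : set V) (f : V -> R) (v w z : V) :
  open U -> U z -> Ck 2 U f -> 'D_v ('D_w f) z = 'D_w ('D_v f) z.
Proof.
move=> oU Uz [df Df].
have [Dvf Cv] := Df v; have [Dwf Cw] := Df w.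
apply: (limit_eq_of_boxes oU Uz (Cw v z Uz) (Cv w z Uz) (v := v) (w := w)).
move=> d d0 dU.
have [|s [r [sd rd E1]]] := @schwarz_mvt _ f v w z d d0.
  by move=> s r sd rd; split; [apply: df|apply: Dvf]; apply: dU.
have [|r' [s' [rd' sd' E2]]] := @schwarz_mvt _ f w v z d d0.
  by move=> a b ad bd; rewrite addrCA; split; [apply: df|apply: Dwf]; apply: dU.
exists s', r', s, r; split; [exact: sd'|exact: rd'|exact: sd|exact: rd|].
have dn0 : d ^+ 2 != 0 by rewrite expf_neq0 // gt_eqF.
apply: (mulfI dn0); rewrite addrCA; apply: (etrans (esym E2)).
apply: etrans E1; rewrite [d *: w + (d *: v + z)]addrCA.
by congr (_ + _); rewrite addrAC.
Qed.

End Smooth.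

(** * The Levi-Civita connection in a chart *)

Section ScalarRules.
Variables (R : realType) (V : normedModType R).
Implicit Types (f g : V -> R).

Lemma differentiable_fsum (I : finType) (P : pred I) (f : I -> V -> R) x :
  (forall i, P i -> differentiable (f i) x) ->
  differentiable (fun y => \sum_(i | P i) f i y) x.
Proof.
move=> H; have -> : (fun y => \sum_(i | P i) f i y) = \sum_(i | P i) f i.
  by apply/funext => y; rewrite fct_sumE.
by elim/big_ind: _ => // ? ? ? ?; apply: differentiableD.
Qed.

Lemma differentiable_fprod (I : finType) (P : pred I) (f : I -> V -> R) x :
  (forall i, P i -> differentiable (f i) x) ->
  differentiable (fun y => \prod_(i | P i) f i y) x.
Proof.
move=> H; have -> : (fun y => \prod_(i | P i) f i y) = \big[*%R/cst 1]_(i | P i) f i.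
  apply/funext => y.
  by elim/big_rec2: _ => [//|i a b _ ->].
elim/big_ind: _ => // ? ? ? ?; exact: differentiableM.
Qed.

Lemma differentiable_det n (F : V -> 'M[R]_n) x :
  (forall i j, differentiable (fun y => F y i j) x) ->
  differentiable (fun y => \det (F y)) x.
Proof.
move=> H; apply: differentiable_fsum => s _.
apply: (@differentiableM _ _ (cst _)) => //.
by apply: differentiable_fprod => i _.
Qed.

Lemma is_derive_fsum n (f : 'I_n -> V -> R) x v (df : 'I_n -> R) :
  (forall i, is_derive x v (f i) (df i)) ->
  is_derive x v (fun y => \sum_i f i y) (\sum_i df i).
Proof.
move=> H; have -> : (fun y => \sum_i f i y) = \sum_i f i.
  by apply/funext => y; rewrite fct_sumE.
exact: is_derive_sum.
Qed.

Lemma is_derive_fmul f g x v df dg :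
  is_derive x v f df -> is_derive x v g dg ->
  is_derive x v (fun y => f y * g y) (df * g x + f x * dg).
Proof.
move=> Hf Hg; have := is_deriveM Hf Hg.
by rewrite [_ *: _ + _]addrC ![_ *: _]mulrC [dg * _]mulrC mulrC.
Qed.

End ScalarRules.
Section Row.
Variables (R : realType) (n : nat).

Lemma bilinE (g : 'M[R]_n) (v w : 'rV[R]_n) :
  bilin g v w = \sum_a \sum_b v 0 a * g a b * w 0 b.
Proof.
rewrite /bilin mxE exchange_big; apply: eq_bigr => b _.
by rewrite !mxE mulr_suml.
Qed.

Lemma partial_chain (V : normedModType R) (f : 'rV[R]_n -> R) (y : V -> 'rV[R]_n) z v :
  differentiable y z -> differentiable f (y z) ->
  is_derive z v (fun x => f (y x))
    (\sum_l partial l f (y z) * 'D_v (fun x => y x 0 l) z).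
Proof.
move=> dy df; have dfy := differentiable_comp dy df.
apply: DeriveDef; first exact: diff_derivable.
rewrite deriveE // (diff_comp dy df) /= -(deriveE v dy).
rewrite (derive_mx (diff_derivable dy)).
set c := (\matrix_(_, _) _ : 'rV_n).
rewrite [c in LHS]row_sum_delta linear_sum; apply: eq_bigr => l _.
by rewrite linearZ /= /partial (deriveE _ df) [_ *: _]mulrC mxE.
Qed.

End Row.

Section Chart.
Variables (R : realType) (n : nat) (M : riemannian_manifold R n) (c : chart_index M).
Local Notation V0 := (chart c @` dom c).
Local Notation g := (metric c).
Local Notation Gam := (christoffel c).

Lemma metric_unit q : V0 q -> g q \in unitmx.
Proof.
move=> Vq; rewrite unitmxE unitfE; apply/negP => /det0P[v v0 vg].
by have := Defs.metric_pos Vq v0; rewrite /bilin vg mul0mx mxE ltxx.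
Qed.

Lemma metric_entry_sym q a b : V0 q -> g q a b = g q b a.
Proof. by move=> Vq; rewrite -[in LHS](Defs.metric_sym Vq) mxE. Qed.

Lemma metric_entry_Ck k a b : Ck k V0 (fun q => g q a b).
Proof. exact: (Ck_coord a b (@chart_open _ _ M c) (@metric_smooth _ _ M c k)). Qed.

Lemma differentiable_metric q a b : V0 q -> differentiable (fun q => g q a b) q.
Proof. by have [H _] := metric_entry_Ck 1 a b; apply: H. Qed.

Lemma differentiable_partial_metric q l a b : V0 q ->
  differentiable (partial l (fun q => g q a b)) q.
Proof. by have [_ /(_ (delta_mx 0 l)) [H _]] := metric_entry_Ck 2 a b; apply: H. Qed.

Lemma partial_metric_sym q l a b : V0 q ->
  partial l (fun q => g q a b) q = partial l (fun q => g q b a) q.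
Proof.
move=> Vq; apply: near_eq_derive.
by apply: (near_of_open (@chart_open _ _ M c) Vq) => q' Vq'; apply: metric_entry_sym.
Qed.

(** Cramer's rule expresses the entries of the inverse by determinants. *)
Lemma differentiable_metric_inv q k l : V0 q ->
  differentiable (fun q => invmx (g q) k l) q.
Proof.
move=> Vq.
apply: (@near_eq_differentiable _ _ _ (fun q => (\det (g q))^-1 * cofactor (g q) l k)).
  apply: (near_of_open (@chart_open _ _ M c) Vq) => q' Vq'.
  by rewrite /invmx metric_unit // !mxE.
apply: differentiableM.
  apply: differentiableV.
    by apply: differentiable_det => i j; apply: differentiable_metric.
  by have := metric_unit Vq; rewrite unitmxE unitfE.
apply: (@differentiableM _ _ (cst _)) => //.
apply: differentiable_det => i j.
have -> : (fun y => row' l (col' k (g y)) i j) = (fun y => g y (lift l i) (lift k j)).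
  by apply/funext => y; rewrite !mxE.
exact: differentiable_metric.
Qed.

Lemma differentiable_christoffel q k a b : V0 q -> differentiable (Gam k a b) q.
Proof.
move=> Vq; apply: (@differentiableM _ _ (cst _)) => //.
apply: differentiable_fsum => l _; apply: differentiableM.
  exact: differentiable_metric_inv.
by apply: differentiableB; [apply: differentiableD|]; apply: differentiable_partial_metric.
Qed.

Lemma christoffel_sym q k a b : V0 q -> Gam k a b q = Gam k b a q.
Proof.
move=> Vq; rewrite /christoffel; congr (_ * _); apply: eq_bigr => l _; congr (_ * _).
by rewrite (partial_metric_sym l a b Vq); ring.
Qed.

(** The covariant derivative of the metric vanishes: lowering an index turns each
    Christoffel symbol into half a sum of three derivatives of the metric, and in
    the sum of two of them four of the six derivatives cancel. *)
Lemma partial_metric_christoffel q l a b : V0 q ->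
  partial l (fun q => g q a b) q
  = \sum_k (Gam k l a q * g q k b + g q a k * Gam k l b q).
Proof.
move=> Vq.
have low a' b' : \sum_k Gam k l a' q * g q k b' =
    2^-1 * (partial l (fun q => g q b' a') q + partial a' (fun q => g q b' l) q
            - partial b' (fun q => g q l a') q).
  rewrite /christoffel.
  under eq_bigr => k _ do rewrite -mulrA mulr_suml.
  rewrite -mulr_sumr exchange_big; congr (_ * _).
  under eq_bigr => j _.
    under eq_bigr => k _ do rewrite mulrAC.
    rewrite -mulr_suml.
    have -> : \sum_k invmx (g q) k j * g q k b' = (b' == j)%:R.
      under eq_bigr => k _ do rewrite mulrC (metric_entry_sym k b' Vq).
      have := congr1 (fun A : 'M[R]_n => A b' j) (mulmxV (metric_unit Vq)).
      by rewrite !mxE => <-.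
    over.
  rewrite (bigD1 b') //= eqxx mul1r big1 ?addr0 // => j /negPf nj.
  by rewrite eq_sym nj mul0r.
rewrite big_split /= low.
under [X in _ + X]eq_bigr => k _ do rewrite mulrC (metric_entry_sym a k Vq).
rewrite low (partial_metric_sym l b a Vq) (partial_metric_sym a b l Vq).
rewrite (partial_metric_sym b l a Vq).
move: (partial l _ q) (partial a _ q) (partial b _ q) => X Y Z.
by field.
Qed.

End Chart.

(** * Covariant derivatives along a map into a chart *)

(** The index computation of [nabla_metric]: [G] stands for the Christoffel
    symbols and [P] for the derivatives of the metric. *)
Lemma metric_compat_sum (B : comNzRingType) n (g : 'M[B]_n)
    (G P : 'I_n -> 'I_n -> 'I_n -> B) (V W dV dW dy : 'I_n -> B) :
  (forall l a b, P l a b = \sum_k (G k l a * g k b + g a k * G k l b)) ->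
  \sum_a \sum_b ((dV a * g a b + V a * \sum_l P l a b * dy l) * W b
                 + V a * g a b * dW b)
  = \sum_a \sum_b (dV a + \sum_i \sum_j G a i j * dy i * V j) * g a b * W b
    + \sum_a \sum_b V a * g a b * (dW b + \sum_i \sum_j G b i j * dy i * W j).
Proof.
move=> PE; pose A k j := \sum_i G k i j * dy i.
have AE k X : \sum_i \sum_j G k i j * dy i * X j = \sum_j A k j * X j.
  by rewrite exchange_big; apply: eq_bigr => j _; rewrite mulr_suml.
have dP a b : \sum_l P l a b * dy l = \sum_k (A k a * g k b + g a k * A k b).
  under eq_bigr => l _ do rewrite PE mulr_suml.
  rewrite exchange_big; apply: eq_bigr => k _ /=; rewrite mulr_suml mulr_sumr -big_split.
  by apply: eq_bigr => l _ /=; ring.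
have V1 : \sum_a \sum_b V a * (\sum_k A k a * g k b) * W b
        = \sum_a \sum_b (\sum_j A a j * V j) * g a b * W b.
  transitivity (\sum_a \sum_b \sum_k V a * A k a * g k b * W b).
    apply: eq_bigr => a _; apply: eq_bigr => b _; rewrite mulr_sumr mulr_suml.
    by apply: eq_bigr => k _; ring.
  transitivity (\sum_k \sum_b \sum_a V a * A k a * g k b * W b).
    under eq_bigr => a _ do rewrite exchange_big.
    by rewrite exchange_big; apply: eq_bigr => k _; rewrite exchange_big.
  apply: eq_bigr => k _; apply: eq_bigr => b _; rewrite !mulr_suml.
  by apply: eq_bigr => a _; ring.
have V2 : \sum_a \sum_b V a * (\sum_k g a k * A k b) * W b
        = \sum_a \sum_b V a * g a b * (\sum_j A b j * W j).
  apply: eq_bigr => a _.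
  transitivity (\sum_b \sum_k V a * g a k * (A k b * W b)).
    by apply: eq_bigr => b _; rewrite mulr_sumr mulr_suml; apply: eq_bigr => k _; ring.
  by rewrite exchange_big; apply: eq_bigr => k _; rewrite mulr_sumr.
under [X in _ = X + _]eq_bigr => a _ do under eq_bigr => b _ do rewrite AE !mulrDl.
under [X in _ = _ + X]eq_bigr => a _ do under eq_bigr => b _ do rewrite AE !mulrDr.
under [LHS]eq_bigr => a _ do under eq_bigr => b _ do rewrite dP big_split /= mulrDr !mulrDl.
have sp (X Y : 'I_n -> 'I_n -> B) : \sum_a \sum_b (X a b + Y a b)
    = \sum_a \sum_b X a b + \sum_a \sum_b Y a b.
  by rewrite -big_split; apply: eq_bigr => a _; rewrite -big_split.
by rewrite !sp V1 V2; ring.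
Qed.

(** The index computation of [ricci_identity]: [G] stands for the Christoffel
    symbols, [dG] for the derivatives of those with upper index [d]; the suffixes
    [v], [w] denote derivatives in these directions.  The terms with a derivative
    of [V] and the term with [yvw] are symmetric in [v] and [w] and cancel. *)
Lemma curvature_sum (B : comNzRingType) n (d : 'I_n) (G : 'I_n -> 'I_n -> 'I_n -> B)
    (dG : 'I_n -> 'I_n -> 'I_n -> B) (yv yw yvw V Vv Vw : 'I_n -> B) (Vvw : B) :
  (Vvw + \sum_i \sum_j (((\sum_l dG l i j * yv l) * yw i + G d i j * yvw i) * V j
                        + G d i j * yw i * Vv j)
   + \sum_i \sum_j G d i j * yv i * (Vw j + \sum_a \sum_b G j a b * yw a * V b))
  - (Vvw + \sum_i \sum_j (((\sum_l dG l i j * yw l) * yv i + G d i j * yvw i) * V j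
                        + G d i j * yv i * Vw j)
   + \sum_i \sum_j G d i j * yw i * (Vv j + \sum_a \sum_b G j a b * yv a * V b))
  = \sum_a \sum_b \sum_k yv a * yw b * V k *
      (dG a b k - dG b a k + \sum_l (G d a l * G l b k - G d b l * G l a k)).
Proof.
pose S2 (f : 'I_n -> 'I_n -> B) := \sum_i \sum_j f i j.
pose S3 (f : 'I_n -> 'I_n -> 'I_n -> B) := \sum_a \sum_b \sum_k f a b k.
have S2D f f' : S2 (fun i j => f i j + f' i j) = S2 f + S2 f'.
  by rewrite /S2 -big_split; apply: eq_bigr => i _; rewrite -big_split.
have S3D f f' : S3 (fun a b k => f a b k + f' a b k) = S3 f + S3 f'.
  rewrite /S3 -big_split; apply: eq_bigr => i _; rewrite -big_split.
  by apply: eq_bigr => j _; rewrite -big_split.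
have S3N f : S3 (fun a b k => - f a b k) = - S3 f.
  rewrite /S3 -sumrN; apply: eq_bigr => i _; rewrite -sumrN.
  by apply: eq_bigr => j _; rewrite -sumrN.
have S3C f : S3 (fun a b k => f b a k) = S3 f by rewrite /S3 exchange_big.
pose T1 (x y : 'I_n -> B) a b k := x a * y b * V k * dG a b k.
pose T2 (x y : 'I_n -> B) a b k := x a * y b * V k * \sum_l G d a l * G l b k.
have F1 x y : S2 (fun i j => (\sum_l dG l i j * x l) * y i * V j) = S3 (T1 x y).
  rewrite /S3 exchange_big; apply: eq_bigr => b _; rewrite exchange_big.
  apply: eq_bigr => k _; rewrite !mulr_suml; apply: eq_bigr => a _.
  by rewrite /T1; ring.
have F2 x y : S2 (fun i j => G d i j * x i * (\sum_a \sum_b G j a b * y a * V b))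
    = S3 (T2 x y).
  apply: eq_bigr => i _.
  transitivity (\sum_a \sum_b \sum_j x i * y a * V b * (G d i j * G j a b)).
    rewrite exchange_big /=; under [RHS]eq_bigr do rewrite exchange_big.
    rewrite exchange_big; apply: eq_bigr => j _ /=.
    rewrite [in RHS]exchange_big mulr_sumr; apply: eq_bigr => a _.
    by rewrite mulr_sumr; apply: eq_bigr => b _; ring.
  by apply: eq_bigr => a _; apply: eq_bigr => b _; rewrite /T2 mulr_sumr.
have E x y xy Vx Vy :
    S2 (fun i j => ((\sum_l dG l i j * x l) * y i + G d i j * xy i) * V j
                   + G d i j * y i * Vx j)
    + S2 (fun i j => G d i j * x i * (Vy j + \sum_a \sum_b G j a b * y a * V b))
  = S3 (T1 x y) + S2 (fun i j => G d i j * xy i * V j)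
    + S2 (fun i j => G d i j * y i * Vx j)
    + (S2 (fun i j => G d i j * x i * Vy j) + S3 (T2 x y)).
  rewrite -F1 -F2; congr (_ + _); rewrite -!S2D; apply: eq_bigr => i _;
    apply: eq_bigr => j _; first by rewrite mulrDl.
  by rewrite mulrDr.
rewrite -[RHS]/(S3 _).
have -> : S3 (fun a b k => yv a * yw b * V k *
      (dG a b k - dG b a k + \sum_l (G d a l * G l b k - G d b l * G l a k)))
   = S3 (T1 yv yw) - S3 (T1 yw yv) + (S3 (T2 yv yw) - S3 (T2 yw yv)).
  rewrite -(S3C (T1 yw yv)) -(S3C (T2 yw yv)) -!S3N -!S3D.
  apply: eq_bigr => a _; apply: eq_bigr => b _; apply: eq_bigr => k _.
  by rewrite /T1 /T2 big_split /= sumrN; ring.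
by rewrite -!(addrA Vvw) !E; ring.
Qed.

Section AlongMap.
Variables (R : realType) (n : nat) (M : riemannian_manifold R n) (c : chart_index M).
Variables (E : normedModType R) (U : set E) (y : E -> 'rV[R]_n).
Hypothesis U_open : open U.
Hypothesis y_smooth : smooth_on U y.
Hypothesis y_chart : forall z, U z -> (chart c @` dom c) (y z).
Local Notation g := (metric c).
Local Notation Gam := (christoffel c).
Local Notation co V d := (fun x : E => V x 0 d).
Implicit Types (v w z : E) (V W : E -> 'rV[R]_n).

(** Along an arbitrary map [y] of a normed space, in order to treat the two
    parameters of a family of curves on the same footing. *)
Definition nabla v V z := 'D_v V z + conn c (y z) ('D_v y z) (V z).

Lemma smooth_diff V z : smooth_on U V -> U z -> differentiable V z.
Proof. by move=> sV Uz; have [H _] := sV 1; apply: H. Qed.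

Lemma smooth_derive V w : smooth_on U V -> smooth_on U ('D_w V).
Proof. by move=> sV k; have [_ H] := sV k.+1; apply: H. Qed.

Lemma derive_coord V z v d : derivable V z v ->
  'D_v V z 0 d = 'D_v (co V d) z.
Proof. by move=> dV; rewrite (derive_mx dV) mxE. Qed.

Lemma derive2_coord V z v w d : smooth_on U V -> U z ->
  'D_v ('D_w V) z 0 d = 'D_v ('D_w (co V d)) z.
Proof.
move=> sV Uz; rewrite derive_coord; last first.
  by apply: diff_derivable; apply: (smooth_diff (smooth_derive w sV)).
apply: near_eq_derive; apply: (near_of_open U_open Uz) => x Ux.
by rewrite derive_coord //; apply: diff_derivable; apply: smooth_diff.
Qed.

Lemma schwarz_coord V z v w d : smooth_on U V -> U z ->
  'D_v ('D_w (co V d)) z = 'D_w ('D_v (co V d)) z.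
Proof.
move=> sV Uz; apply: (schwarz v w U_open Uz).
exact: (Ck_coord 0 d U_open (sV 2)).
Qed.

Lemma schwarz_row V z v w : smooth_on U V -> U z ->
  'D_v ('D_w V) z = 'D_w ('D_v V) z.
Proof.
move=> sV Uz; apply/rowP => d.
exact: (etrans (derive2_coord v w d sV Uz)
  (etrans (schwarz_coord v w d sV Uz) (esym (derive2_coord w v d sV Uz)))).
Qed.

Lemma differentiable_derive_coord V z w d : smooth_on U V -> U z ->
  differentiable ('D_w (co V d)) z.
Proof.
move=> sV Uz; have [_ /(_ w) [H _]] := Ck_coord 0 d U_open (sV 2); exact: H.
Qed.

Lemma differentiable_coord_field V z d : differentiable V z -> differentiable (co V d) z.
Proof.
move=> dV; apply: (@differentiable_comp _ _ _ _ V (fun A : 'rV[R]_n => A 0 d)) => //.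
exact: differentiable_coord.
Qed.

Lemma connE q (a b : 'rV[R]_n) d :
  conn c q a b 0 d = \sum_i \sum_j Gam d i j q * a 0 i * b 0 j.
Proof. by rewrite mxE. Qed.

Lemma nabla_coord v V z d : U z -> derivable V z v ->
  nabla v V z 0 d = 'D_v (co V d) z
    + \sum_i \sum_j Gam d i j (y z) * 'D_v (co y i) z * V z 0 j.
Proof.
move=> Uz dV; rewrite /nabla mxE connE (derive_coord _ dV); congr (_ + _).
apply: eq_bigr => i _; apply: eq_bigr => j _.
by rewrite (derive_coord _ (diff_derivable (smooth_diff y_smooth Uz))).
Qed.

(** Both terms are symmetric: the second derivatives by Schwarz's theorem, the
    connection term by the symmetry of the Christoffel symbols. *)
Lemma nabla_torsion_free v w z : U z -> nabla v ('D_w y) z = nabla w ('D_v y) z.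
Proof.
move=> Uz; have conn_sym a b : conn c (y z) a b = conn c (y z) b a.
  apply/rowP => d; rewrite !connE exchange_big; apply: eq_bigr => i _.
  by apply: eq_bigr => j _; rewrite (christoffel_sym _ _ _ (y_chart Uz)); ring.
by rewrite /nabla (schwarz_row v w y_smooth Uz) conn_sym.
Qed.

Lemma nabla_metric v V W z : U z -> derivable V z v -> derivable W z v ->
  is_derive z v (fun x => bilin (g (y x)) (V x) (W x))
    (bilin (g (y z)) (nabla v V z) (W z) + bilin (g (y z)) (V z) (nabla v W z)).
Proof.
move=> Uz dV dW; have dy := smooth_diff y_smooth Uz; have Vq := y_chart Uz.
have -> : (fun x => bilin (g (y x)) (V x) (W x))
   = (fun x => \sum_a \sum_b V x 0 a * g (y x) a b * W x 0 b).
  by apply/funext => x; rewrite bilinE.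
have isd (F : E -> 'rV[R]_n) d : derivable F z v -> is_derive z v (co F d) ('D_v (co F d) z).
  by move=> dF; apply: derivableP; have /derivable_mxP := dF; apply.
apply: is_derive_eq.
  apply: is_derive_fsum => a; apply: is_derive_fsum => b.
  apply: is_derive_fmul; last exact: isd.
  apply: is_derive_fmul; first exact: isd.
  exact: (partial_chain (f := fun q => g q a b) v dy (differentiable_metric a b Vq)).
rewrite !bilinE.
have nE (F : E -> 'rV[R]_n) : derivable F z v -> forall d, nabla v F z 0 d = _ :=
  fun dF d => @nabla_coord v F z d Uz dF.
under [X in _ = X + _]eq_bigr => a _ do under eq_bigr => b _ do rewrite (nE V dV).
under [X in _ = _ + X]eq_bigr => a _ do under eq_bigr => b _ do rewrite (nE W dW).
rewrite -(@metric_compat_sum _ _ _ _ (fun l a b => partial l (fun q => g q a b) (y z))) //.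
by move=> l a b; apply: partial_metric_christoffel.
Qed.

(** The values of the second derivatives are parameters, so that both orders of
    differentiation can be brought to the same mixed derivatives. *)
Lemma nabla_coord_derive v w V z d (Vvw : R) (yvw : 'I_n -> R) :
  smooth_on U V -> U z ->
  'D_v ('D_w (co V d)) z = Vvw -> (forall i, 'D_v ('D_w (co y i)) z = yvw i) ->
  is_derive z v (co (nabla w V) d)
   (Vvw + \sum_i \sum_j
     (((\sum_l partial l (Gam d i j) (y z) * 'D_v (co y l) z) * 'D_w (co y i) z
       + Gam d i j (y z) * yvw i) * V z 0 j
      + Gam d i j (y z) * 'D_w (co y i) z * 'D_v (co V j) z)).
Proof.
move=> sV Uz EV Ey; have dy := smooth_diff y_smooth Uz; have Vq := y_chart Uz.
apply: (near_eq_is_derive (f := fun x => 'D_w (co V d) x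
    + \sum_i \sum_j Gam d i j (y x) * 'D_w (co y i) x * V x 0 j)).
  apply: (near_of_open U_open Uz) => x Ux; rewrite nabla_coord //.
  exact/diff_derivable/smooth_diff.
have dD (F : E -> 'rV[R]_n) i a : smooth_on U F -> 'D_v ('D_w (co F i)) z = a ->
    is_derive z v ('D_w (co F i)) a.
  move=> sF <-.
  apply: derivableP; apply: diff_derivable.
  exact: (differentiable_derive_coord w i sF Uz).
apply: (is_deriveD (dD V d _ sV EV)).
apply: is_derive_fsum => i; apply: is_derive_fsum => j.
apply: is_derive_fmul; last first.
  apply: derivableP; apply: diff_derivable; apply: differentiable_coord_field.
  exact: smooth_diff.
apply: is_derive_fmul; last exact: (dD y i _ y_smooth (Ey i)).
exact: (partial_chain (f := Gam d i j) v dy (differentiable_christoffel d i j Vq)).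
Qed.

Lemma derivable_nabla v w V z : smooth_on U V -> U z -> derivable (nabla w V) z v.
Proof.
move=> sV Uz; apply/derivable_mxP => i d; rewrite ord1.
exact: (@ex_derive _ _ _ _ _ _ _ (@nabla_coord_derive v w V z d _ _ sV Uz erefl (fun=> erefl))).
Qed.

Lemma ricci_identity v w V z : smooth_on U V -> U z ->
  nabla v (nabla w V) z - nabla w (nabla v V) z
  = curv c (y z) ('D_v y z) ('D_w y z) (V z).
Proof.
move=> sV Uz; apply/rowP => d.
have dV x : derivable V z x by exact/diff_derivable/smooth_diff.
have dy x : derivable y z x by exact/diff_derivable/smooth_diff.
have nn a b : nabla a (nabla b V) z 0 d = _ :=
  nabla_coord d Uz (@derivable_nabla a b V z sV Uz).
have n1 a j : nabla a V z 0 j = _ := nabla_coord j Uz (dV a).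
have D1 := @nabla_coord_derive v w V z d _ _ sV Uz erefl (fun=> erefl).
have D2 := @nabla_coord_derive w v V z d _ _ sV Uz
  (schwarz_coord w v d sV Uz) (fun i => schwarz_coord w v i y_smooth Uz).
have N1 := etrans (nn v w) (congr1 (fun X => X + _) (@derive_val _ _ _ _ _ _ _ D1)).
have N2 := etrans (nn w v) (congr1 (fun X => X + _) (@derive_val _ _ _ _ _ _ _ D2)).
have sub_coord (A B : 'rV[R]_n) a b : A 0 d = a -> B 0 d = b -> (A - B) 0 d = a - b.
  by move=> <- <-; rewrite !mxE.
apply: (etrans (sub_coord _ _ _ _ N1 N2)) => {N1 N2 D1 D2 nn}.
under [X in _ + X - _]eq_bigr => i _ do under eq_bigr => j _ do rewrite n1.
under [X in _ - (_ + X)]eq_bigr => i _ do under eq_bigr => j _ do rewrite n1.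
rewrite [RHS]mxE.
under [RHS]eq_bigr => a _ do under eq_bigr => b _ do under eq_bigr => k _ do
  rewrite (derive_coord a (dy v)) (derive_coord b (dy w)).
exact: (@curvature_sum _ _ d (fun k i j => Gam k i j (y z))
  (fun l i j => partial l (Gam d i j) (y z))).
Qed.

End AlongMap.

(** * Orthonormal frames along a map *)

Section BilinFrame.
Variables (R : realType) (n : nat).
Implicit Types (g : 'M[R]_n) (v w : 'rV[R]_n) (e : 'I_n -> 'rV[R]_n).

Lemma bilin_suml g (F : 'I_n -> 'rV[R]_n) (a : 'I_n -> R) w :
  bilin g (\sum_i a i *: F i) w = \sum_i a i * bilin g (F i) w.
Proof.
rewrite /bilin !mulmx_suml summxE; apply: eq_bigr => i _.
by rewrite -!scalemxAl mxE.
Qed.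

Lemma bilinC g v w : g^T = g -> bilin g v w = bilin g w v.
Proof.
move=> gT; rewrite !bilinE exchange_big; apply: eq_bigr => a _; apply: eq_bigr => b _.
by rewrite -{1}gT mxE; ring.
Qed.

Lemma bilinBl g v v' w : bilin g (v - v') w = bilin g v w - bilin g v' w.
Proof. by rewrite /bilin !mulmxBl !mxE. Qed.

Lemma trilinear_sum (K : 'I_n -> 'I_n -> 'I_n -> R) (v z h : 'I_n -> R)
    (F : 'I_n -> 'I_n -> R) :
  \sum_a \sum_b \sum_k v a * (\sum_l h l * F l b) * z k * K a b k
  = \sum_l h l * \sum_a \sum_b \sum_k v a * F l b * z k * K a b k.
Proof.
under [RHS]eq_bigr do rewrite mulr_sumr.
rewrite [RHS]exchange_big; apply: eq_bigr => a _ /=.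
under [RHS]eq_bigr do rewrite mulr_sumr.
rewrite [RHS]exchange_big; apply: eq_bigr => b _ /=.
under [RHS]eq_bigr do rewrite mulr_sumr.
rewrite [RHS]exchange_big; apply: eq_bigr => k _ /=.
by rewrite mulr_sumr !mulr_suml; apply: eq_bigr => l _; ring.
Qed.

End BilinFrame.

Section Frame.
Variables (R : realType) (n : nat) (M : riemannian_manifold R n) (c : chart_index M).
Variables (E : normedModType R) (U : set E) (y : E -> 'rV[R]_n).
Hypothesis U_open : open U.
Hypothesis y_smooth : smooth_on U y.
Hypothesis y_chart : forall z, U z -> (chart c @` dom c) (y z).
Variable e : 'I_n -> E -> 'rV[R]_n.
Hypothesis e_smooth : forall a, smooth_on U (e a).
Hypothesis e_orth : forall z, U z -> Defs.orthonormal c (y z) (fun a => e a z).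
Local Notation g := (metric c).
Local Notation nabla := (nabla c y).
Local Notation ip z V W := (bilin (g (y z)) V W).

(** [A] is the connection form of the frame, contracted with [v]. *)
Definition connection_matrix v (A : 'I_n -> 'I_n -> E -> R) :=
  forall z, U z -> forall a, nabla v (e a) z = \sum_b A a b z *: e b z.

Lemma ipC z V W : U z -> ip z V W = ip z W V.
Proof. by move=> Uz; apply: bilinC; apply: Defs.metric_sym; apply: y_chart. Qed.

Lemma frame_coef z (a : 'I_n -> R) b : U z -> ip z (\sum_d a d *: e d z) (e b z) = a b.
Proof.
move=> Uz; rewrite bilin_suml (bigD1 b) //= (e_orth Uz) eqxx mulr1 big1 ?addr0 //.
by move=> d /negPf db; rewrite (e_orth Uz) db mulr0.
Qed.

Lemma derivable_field v z (V : E -> 'rV[R]_n) : smooth_on U V -> U z -> derivable V z v.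
Proof. by move=> sV Uz; apply: diff_derivable; apply: smooth_diff Uz. Qed.

(** The derivative of the constants [<e_a, e_b>]. *)
Lemma connection_skew v A z a b : connection_matrix v A -> U z ->
  A a b z + A b a z = 0.
Proof.
move=> cA Uz.
have H := nabla_metric y_smooth y_chart Uz
  (@derivable_field v z _ (e_smooth a) Uz) (@derivable_field v z _ (e_smooth b) Uz).
have H0 : is_derive z v (cst ((a == b)%:R : R)) 0 by apply: is_derive_cst.
have H1 := near_eq_is_derive (near_of_open U_open Uz (fun x Ux => e_orth Ux a b)) H.
have := @derive_val _ _ _ _ _ _ _ H1.
rewrite (@derive_val _ _ _ _ _ _ _ H0) !cA // (ipC (e a z)) // !frame_coef //.
Qed.

(** [A a b = <nabla_v e_a, e_b>] is differentiated with [nabla_metric]. *)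
Lemma connection_derive v w A B z a b :
  connection_matrix v A -> connection_matrix w B -> U z ->
  is_derive z w (A a b)
    (ip z (nabla w (nabla v (e a)) z) (e b z) + \sum_d A a d z * B b d z).
Proof.
move=> cA cB Uz.
have H := nabla_metric y_smooth y_chart Uz
  (@derivable_nabla _ _ _ _ _ _ _ U_open y_smooth y_chart w v _ _ (e_smooth a) Uz)
  (@derivable_field w z _ (e_smooth b) Uz).
apply: (near_eq_is_derive (f := fun x => ip x (nabla v (e a) x) (e b x))).
  by apply: (near_of_open U_open Uz) => x Ux; rewrite cA // frame_coef.
apply: is_derive_eq H _; congr (_ + _).
rewrite cA // bilin_suml; apply: eq_bigr => d _.
by rewrite cB // ipC // frame_coef.
Qed.

(** Differentiating [h_b = <D_w y, e_b>] along [v] and using the symmetry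
    [nabla_v D_w y = nabla_w D_v y]. *)
Lemma coframe_derive v w A B z (h : 'I_n -> E -> R) o b :
  connection_matrix v A -> connection_matrix w B ->
  (forall x, U x -> 'D_v y x = e o x) ->
  (forall x, U x -> 'D_w y x = \sum_l h l x *: e l x) ->
  U z -> is_derive z v (h b) (B o b z + \sum_d h d z * A b d z).
Proof.
move=> cA cB ev eh Uz.
have H := nabla_metric y_smooth y_chart Uz
  (@derivable_field v z _ (smooth_derive w y_smooth) Uz)
  (@derivable_field v z _ (e_smooth b) Uz).
apply: (near_eq_is_derive (f := fun x => ip x ('D_w y x) (e b x))).
  by apply: (near_of_open U_open Uz) => x Ux; rewrite eh // frame_coef.
apply: is_derive_eq H _.
rewrite (nabla_torsion_free U_open y_smooth y_chart v w Uz).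
have -> : nabla w ('D_v y) z = nabla w (e o) z.
  have En : 'D_w ('D_v y) z = 'D_w (e o) z.
    by apply: near_eq_derive; apply: (near_of_open U_open Uz ev).
  by rewrite /nabla En ev.
rewrite cB // frame_coef // eh // bilin_suml; congr (_ + _); apply: eq_bigr => d _.
by rewrite cA // ipC // frame_coef.
Qed.

Lemma curv_lincomb q v z (h : 'I_n -> R) (F : 'I_n -> 'rV[R]_n) :
  curv c q v (\sum_l h l *: F l) z = \sum_l h l *: curv c q v (F l) z.
Proof.
apply/rowP => d.
have lc b : (\sum_l h l *: F l) 0 b = \sum_l h l * F l 0 b.
  by rewrite summxE; apply: eq_bigr => l _; rewrite mxE.
rewrite [RHS]summxE [LHS]mxE.
under [LHS]eq_bigr => a _ do under eq_bigr => b _ do under eq_bigr => k _ do rewrite lc.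
under [RHS]eq_bigr => l _ do rewrite scalemxE [X in _ * X]mxE.
exact: trilinear_sum.
Qed.

(** Subtracting the two instances of [connection_derive] leaves the commutator of
    the covariant derivatives, which is the curvature. *)
Lemma structure_equation kap v w A B z (h : 'I_n -> E -> R) o a b dA dB :
  constant_curvature M kap ->
  connection_matrix v A -> connection_matrix w B ->
  (forall x, U x -> 'D_v y x = e o x) ->
  (forall x, U x -> 'D_w y x = \sum_l h l x *: e l x) -> U z ->
  is_derive z w (A a b) dA -> is_derive z v (B a b) dB ->
  dB - dA = kap * ((a == o)%:R * h b z - h a z * (b == o)%:R)
     + \sum_d (B a d z * A b d z - A a d z * B b d z).
Proof.
move=> cc cA cB ev eh Uz HA HB.
have := @derive_val _ _ _ _ _ _ _ HA.
rewrite (@derive_val _ _ _ _ _ _ _ (connection_derive a b cA cB Uz)) => <- {HA}.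
have := @derive_val _ _ _ _ _ _ _ HB.
rewrite (@derive_val _ _ _ _ _ _ _ (connection_derive a b cB cA Uz)) => <- {HB}.
rewrite sumrB opprD addrACA; congr (_ + _).
rewrite -bilinBl (ricci_identity U_open y_smooth y_chart v w (e_smooth a) Uz).
rewrite ev // eh // curv_lincomb bilin_suml.
have [p dp yp] := y_chart Uz.
have cp := cc c p (fun i => e i z) dp.
rewrite yp in cp.
under eq_bigr => l _ do rewrite (cp (e_orth Uz)).
rewrite (eq_bigr (fun l => kap * (a == o)%:R * ((b == l)%:R * h l z)
     - kap * (b == o)%:R * ((a == l)%:R * h l z))); last by move=> l _; ring.
rewrite big_split /= sumrN -!mulr_sumr.
have pick i : \sum_l (i == l)%:R * h l z = h i z.
  rewrite (bigD1 i) //= eqxx mul1r big1 ?addr0 // => l /negPf nl.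
  by rewrite eq_sym nl mul0r.
by rewrite !pick; ring.
Qed.

End Frame.

(** * The natural frame of a family of curves *)

Section TwoParameters.
Variables (R : realType) (W : normedModType R).
Implicit Types (F : R * R -> W) (x t : R).

Local Notation dirx := ((1, 0) : R * R).
Local Notation dirt := ((0, 1) : R * R).

Lemma line_x x t : x *: dirx + (0, t) = (x, t).
Proof.
apply/pair_equal_spec; split=> /=; first by rewrite [_ *: _]mulr1 addr0.
by rewrite [_ *: _]mulr0 add0r.
Qed.

Lemma line_t x t : t *: dirt + (x, 0) = (x, t).
Proof.
apply/pair_equal_spec; split=> /=; last by rewrite [_ *: _]mulr1 addr0.
by rewrite [_ *: _]mulr0 add0r.
Qed.

Lemma is_derive_x F x t d :
  is_derive (x, t) dirx F d -> is_derive x 1 (fun s => F (s, t)) d.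
Proof.
move=> [dF <-]; rewrite -line_x in dF *.
have -> : (fun s => F (s, t)) = (fun s => F (s *: dirx + (0, t))).
  by apply/funext => s; rewrite line_x.
exact: is_derive_line.
Qed.

Lemma is_derive_t F x t d :
  is_derive (x, t) dirt F d -> is_derive t 1 (fun s => F (x, s)) d.
Proof.
move=> [dF <-]; rewrite -line_t in dF *.
have -> : (fun s => F (x, s)) = (fun s => F (s *: dirt + (x, 0))).
  by apply/funext => s; rewrite line_t.
exact: is_derive_line.
Qed.

Lemma derive1_x F x t : derivable F (x, t) dirx ->
  derive1 (fun s => F (s, t)) x = 'D_dirx F (x, t).
Proof.
move=> dF; rewrite derive1E.
by have [_] := is_derive_x (derivableP dF).
Qed.

Lemma derive1_t F x t : derivable F (x, t) dirt ->
  derive1 (fun s => F (x, s)) t = 'D_dirt F (x, t).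
Proof.
move=> dF; rewrite derive1E.
by have [_] := is_derive_t (derivableP dF).
Qed.

End TwoParameters.

Section NaturalFrame.
Variables (R : realType) (m : nat) (M : riemannian_manifold R m.+1) (kap : R).
Hypothesis M_curv : constant_curvature M kap.
Variables (X T : set R) (gam : R -> R -> M).
Hypotheses (X_open : open X) (T_open : open T).
Hypothesis gam_smooth : smooth_family X T gam.
Variables (e : 'I_m.+1 -> vfield M) (u : 'I_m -> R -> R -> R).
Hypothesis e_natural : natural_frame X T gam e u.
Variables (h : 'I_m.+1 -> R -> R -> R) (om : 'I_m.+1 -> 'I_m.+1 -> R -> R -> R).
Hypothesis gam_t_e : along_eq X T gam (gam_t gam) (lincomb h e).
Hypothesis om_t : forall a, along_eq X T gam (nabla_t gam (e a)) (lincomb (om a) e).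

(** The connection form of the natural frame in direction [x]; [unlift ord0]
    separates the tangent, index [ord0], from the normals. *)
Definition natural_matrix (a b : 'I_m.+1) (x t : R) : R :=
  match unlift ord0 a, unlift ord0 b with
  | None, Some i => u i x t
  | Some i, None => - u i x t
  | _, _ => 0
  end.

Lemma chart_domain_open c :
  open [set z : R * R | [/\ X z.1, T z.2 & dom c (gam z.1 z.2)]].
Proof.
rewrite openE => -[x t] /= [Xx Tt dx]; rewrite /interior.
have [cg _] := gam_smooth.
have nx : \forall z \near (x, t), X z.1.
  by apply: (@cvg_fst _ _ (nbhs x) (nbhs t)); apply: open_nbhs_nbhs.
have nt : \forall z \near (x, t), T z.2.
  by apply: (@cvg_snd _ _ (nbhs x) (nbhs t)); apply: open_nbhs_nbhs.
have nd : \forall z \near (x, t), dom c (gam z.1 z.2).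
  by apply: (cg x t Xx Tt); apply: open_nbhs_nbhs; split => //; apply: dom_open.
by apply: filterS (filterI nx (filterI nt nd)) => z [? [? ?]].
Qed.

(** All equations are local, so at each point one chart suffices; the frame along
    the curves becomes a frame along the map [y] of the plane into that chart. *)
Lemma frame_equations x t : X x -> T t ->
  [/\ forall a b, om a b x t + om b a x t = 0,
      forall b, is_derive x 1 (fun s => h b s t)
        (om ord0 b x t + \sum_d h d x t * natural_matrix b d x t)
    & forall a b, exists dk dw,
        [/\ is_derive t 1 (fun s => natural_matrix a b x s) dk,
            is_derive x 1 (fun s => om a b s t) dw
          & dw - dk = kap * ((a == ord0)%:R * h b x t - h a x t * (b == ord0)%:R)
              + \sum_d (om a d x t * natural_matrix b d x t
                        - natural_matrix a d x t * om b d x t)]].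
Proof.
move=> Xx Tt; have [c dc] := dom_cover (gam x t).
pose U := [set z : R * R | [/\ X z.1, T z.2 & dom c (gam z.1 z.2)]].
have Uz : U (x, t) by [].
have Uo : open U by apply: chart_domain_open.
pose y (z : R * R) := chart c (gam z.1 z.2).
have ys : smooth_on U y by have [_] := gam_smooth; apply.
have yc z : U z -> (chart c @` dom c) (y z) by move=> [_ _ dz]; exists (gam z.1 z.2).
pose ee a (z : R * R) := e a c z.1 z.2.
have [[e_al _] eo e0 ex0 exi] := e_natural.
have es a : smooth_on U (ee a) by have [_] := e_al a; apply.
have eorth z : U z -> Defs.orthonormal c (y z) (fun a => ee a z).
  by move=> [Xz Tz dz]; apply: eo.
pose dirx := (1, 0) : R * R; pose dirt := (0, 1) : R * R.
have dsm (V : R * R -> 'rV[R]_m.+1) z v : smooth_on U V -> U z -> derivable V z v.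
  by move=> sV Vz; apply: diff_derivable; apply: (smooth_diff sV Vz).
have gx z : U z -> gam_x gam c z.1 z.2 = 'D_dirx y z.
  by case: z => a b Vz; apply: (@derive1_x _ _ y a b); apply: dsm.
have gt z : U z -> gam_t gam c z.1 z.2 = 'D_dirt y z.
  by case: z => a b Vz; apply: (@derive1_t _ _ y a b); apply: dsm.
have ex z : U z -> forall a, nabla_x gam (e a) c z.1 z.2 = nabla c y dirx (ee a) z.
  case: z => r s Vz a.
  have E := @derive1_x _ _ (ee a) r s (dsm (ee a) (r, s) dirx (es a) Vz).
  exact: (f_equal2 (fun P Q => P + conn c (y (r, s)) Q (ee a (r, s))) E (gx _ Vz)).
have et z : U z -> forall a, nabla_t gam (e a) c z.1 z.2 = nabla c y dirt (ee a) z.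
  case: z => r s Vz a.
  have E := @derive1_t _ _ (ee a) r s (dsm (ee a) (r, s) dirt (es a) Vz).
  exact: (f_equal2 (fun P Q => P + conn c (y (r, s)) Q (ee a (r, s))) E (gt _ Vz)).
pose A a b (z : R * R) := natural_matrix a b z.1 z.2.
pose B a b (z : R * R) := om a b z.1 z.2.
have cA : connection_matrix c U y ee dirx A.
  move=> z Vz a; have [Xz Tz dz] := Vz; rewrite -ex //.
  case: (unliftP ord0 a) => [i ->|->].
    rewrite exi // big_ord_recl /A /natural_matrix liftK unlift_none scaleNr.
    by rewrite big1 ?addr0 // => j _; rewrite liftK scale0r.
  rewrite ex0 // big_ord_recl /A /natural_matrix unlift_none scale0r add0r.
  by apply: eq_bigr => j _; rewrite liftK.
have cB : connection_matrix c U y ee dirt B.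
  by move=> z Vz a; have [Xz Tz dz] := Vz; rewrite -et // om_t.
have ev z : U z -> 'D_dirx y z = ee ord0 z.
  by move=> Vz; have [Xz Tz dz] := Vz; rewrite -gx // /ee e0.
have eh z : U z -> 'D_dirt y z = \sum_l h l z.1 z.2 *: ee l z.
  by move=> Vz; have [Xz Tz dz] := Vz; rewrite -gt // gam_t_e.
split=> [a b|b|a b].
- exact: (connection_skew Uo ys yc es eorth a b cB Uz).
- apply: (@is_derive_x _ _ (fun z => h b z.1 z.2)).
  exact: (coframe_derive Uo ys yc es eorth b cA cB ev eh Uz).
- have DA := connection_derive Uo ys yc es eorth a b cA cB Uz.
  have DB := connection_derive Uo ys yc es eorth a b cB cA Uz.
  eexists; eexists; split; [exact: (is_derive_t DA)|exact: (is_derive_x DB)|].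
  exact: (structure_equation Uo ys yc es eorth M_curv cA cB ev eh Uz DA DB).
Qed.

End NaturalFrame.

(** * The evolution of the curvatures *)

Section FunctionRing.
Variables (R : realType) (m : nat).
Implicit Types (a b : 'cV[R -> R]_m) (x : R).

Lemma subr_eval (f g : R -> R) x : (f - g) x = f x - g x.
Proof. by []. Qed.

Lemma dot_eval a b x : dot a b x = \sum_k a k 0 x * b k 0 x.
Proof. by rewrite /dot fct_sumE. Qed.

Lemma dot_Jmx_eval i j a b x :
  dot (Jmx _ i j *m a) b x = b i 0 x * a j 0 x - a i 0 x * b j 0 x.
Proof. by rewrite dot_Jmx wedgeE. Qed.

Lemma JmxM_eval i j a k x :
  (Jmx _ i j *m a) k 0 x = (Jmx R i j *m \col_l a l 0 x) k 0.
Proof.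
rewrite !JmxM !mxE; case: (i == k); case: (j == k);
  by rewrite ?mul1r ?mul0r /= ?subr0 ?sub0r.
Qed.

(** [Rop] over the ring of functions, evaluated at one point: if the inner
    integrals are antisymmetric at that point, [sum_Jmx] applies there. *)
Lemma Rop_eval (D Di : (R -> R) -> R -> R) a b k x (A : 'M[R]_m) :
  (forall i j, Di (dot (Jmx _ i j *m map_mx D a) b) x = A i j) ->
  (forall i j, A j i = - A i j) -> (forall i, A i i = 0) ->
  Rop D Di a b k 0 x = D (D (b k 0)) x + (\sum_l a l 0 x * a l 0 x) * b k 0 x
    + Di (dot a b) x * D (a k 0) x - \sum_l A k l * a l 0 x.
Proof.
move=> EA As Ad; rewrite /Rop 3!addmxE oppmxE 2!scalemxE !mapmxE summxE.
rewrite -[LHS]/(D (D (b k 0)) x + dot a a x * b k 0 x + Di (dot a b) x * D (a k 0) x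
  - (\sum_(i < m) (\sum_(j < m | (i < j)%N) Di (dot (Jmx _ i j *m map_mx D a) b)
       *: (Jmx _ i j *m a)) k 0) x).
rewrite dot_eval fct_sumE; congr (_ - _).
have := congr1 (fun V : 'cV[R]_m => V k 0) (sum_Jmx (\col_l a l 0 x) As Ad).
rewrite summxE [RHS]mxE.
under [X in _ = X -> _]eq_bigr => l _ do rewrite mxE.
move=> <-; apply: eq_bigr => i _; rewrite !summxE fct_sumE; apply: eq_bigr => j _.
by rewrite !scalemxE -EA -JmxM_eval.
Qed.

End FunctionRing.

Section Evolution.
Variables (R : realType) (m : nat) (M : riemannian_manifold R m.+1) (kap : R).
Hypothesis M_curv : constant_curvature M kap.
Variables (X T : set R) (gam : R -> R -> M).
Hypotheses (X_open : open X) (T_open : open T).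
Hypothesis gam_smooth : smooth_family X T gam.
Variables (e : 'I_m.+1 -> vfield M) (u : 'I_m -> R -> R -> R).
Hypothesis e_natural : natural_frame X T gam e u.
Variables (h : 'I_m.+1 -> R -> R -> R) (om : 'I_m.+1 -> 'I_m.+1 -> R -> R -> R).
Hypothesis gam_t_e : along_eq X T gam (gam_t gam) (lincomb h e).
Hypothesis om_t : forall a, along_eq X T gam (nabla_t gam (e a)) (lincomb (om a) e).
Variables (Z : set (R -> R)) (Di : (R -> R) -> (R -> R)).
Hypothesis Di_inv : formal_inverse X Z Di.
Let hn (i : 'I_m) := h (lift ord0 i).
Let w (i j : 'I_m) := om (lift ord0 i) (lift ord0 j).
Let w0 (i : 'I_m) := om ord0 (lift ord0 i).
Hypothesis Z_const : forall t, T t ->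
  [/\ Z (fun x => h ord0 x t), forall i j, Z (fun x => w i j x t)
    & forall i j : 'I_m, Z (dot (Jmx _ i j *m slice u t) (slice hn t))].

Lemma natural_matrixE i j x t :
  [/\ natural_matrix u ord0 ord0 x t = 0,
      natural_matrix u ord0 (lift ord0 i) x t = u i x t,
      natural_matrix u (lift ord0 i) ord0 x t = - u i x t
    & natural_matrix u (lift ord0 i) (lift ord0 j) x t = 0].
Proof. by rewrite /natural_matrix unlift_none !liftK. Qed.

Let FE x t Xx Tt := @frame_equations R m M kap M_curv X T gam X_open T_open
  gam_smooth e u e_natural h om gam_t_e om_t x t Xx Tt.

Let lift_neq0 (i : 'I_m) : (lift ord0 i == ord0) = false.
Proof. by []. Qed.

Lemma om_skew x t a b : X x -> T t -> om b a x t = - om a b x t.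
Proof. by move=> Xx Tt; have [H _ _] := FE Xx Tt; apply/eqP; rewrite -addr_eq0 H. Qed.

Lemma om_diag x t a : X x -> T t -> om a a x t = 0.
Proof. by move=> Xx Tt; have [H _ _] := FE Xx Tt; have := H a a; lra. Qed.

Lemma tangential_derive x t : X x -> T t ->
  is_derive x 1 (fun s => h ord0 s t) (\sum_i u i x t * hn i x t).
Proof.
move=> Xx Tt; have [_ H _] := FE Xx Tt; apply: is_derive_eq (H ord0) _.
rewrite (om_diag _ Xx Tt) add0r big_ord_recl {1}/natural_matrix unlift_none mulr0 add0r.
by apply: eq_bigr => i _; have [_ -> _ _] := natural_matrixE i i x t; rewrite mulrC.
Qed.

Lemma normal_derive x t i : X x -> T t ->
  is_derive x 1 (fun s => hn i s t) (w0 i x t - h ord0 x t * u i x t).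
Proof.
move=> Xx Tt; have [_ H _] := FE Xx Tt; apply: is_derive_eq (H (lift ord0 i)) _.
rewrite big_ord_recl big1 ?addr0; last first.
  by move=> j _; have [_ _ _ ->] := natural_matrixE i j x t; rewrite mulr0.
by have [_ _ -> _] := natural_matrixE i i x t; rewrite mulrN.
Qed.

Lemma rotation_derive x t i j : X x -> T t ->
  is_derive x 1 (fun s => w i j s t) (w0 i x t * u j x t - u i x t * w0 j x t).
Proof.
move=> Xx Tt; have [_ _ H] := FE Xx Tt.
have [dk [dw [Hk Hw E]]] := H (lift ord0 i) (lift ord0 j).
apply: is_derive_eq Hw _.
have dk0 : dk = 0.
  have Ek : (fun s => natural_matrix u (lift ord0 i) (lift ord0 j) x s) = cst 0.
    by apply/funext => s; have [_ _ _ ->] := natural_matrixE i j x s.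
  rewrite Ek in Hk; rewrite -(@derive_val _ _ _ _ _ _ _ Hk).
  exact: derive_cst.
move: E; rewrite dk0 subr0 => ->; rewrite !lift_neq0 mul0r mulr0 subrr mulr0 add0r.
rewrite big_ord_recl big1 ?addr0; last first.
  move=> k _; have [_ _ _ ->] := natural_matrixE i k x t.
  by have [_ _ _ ->] := natural_matrixE j k x t; rewrite mulr0 mul0r subrr.
have [_ _ -> _] := natural_matrixE i i x t; have [_ _ -> _] := natural_matrixE j j x t.
by rewrite (om_skew ord0 (lift ord0 i) Xx Tt) (om_skew ord0 (lift ord0 j) Xx Tt) /w0; ring.
Qed.

Lemma curvature_derive x t i : X x -> T t -> exists du dw,
  [/\ is_derive t 1 (fun s => u i x s) du, is_derive x 1 (fun s => w0 i s t) dw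
    & du = dw - kap * hn i x t + \sum_j w i j x t * u j x t].
Proof.
move=> Xx Tt; have [_ _ H] := FE Xx Tt.
have [dk [dw [Hk Hw E]]] := H ord0 (lift ord0 i).
have Ek : (fun s => natural_matrix u ord0 (lift ord0 i) x s) = (fun s => u i x s).
  by apply/funext => s; have [_ -> _ _] := natural_matrixE i i x s.
rewrite Ek in Hk; exists dk, dw; split=> //.
move: E; rewrite eqxx lift_neq0 mul1r mulr0 subr0.
rewrite big_ord_recl (om_diag _ Xx Tt) mul0r add0r.
have [-> _ _ _] := natural_matrixE i i x t; rewrite mul0r oppr0 add0r.
have -> : \sum_(j < m) (om ord0 (lift ord0 j) x t * natural_matrix u (lift ord0 i) (lift ord0 j) x t
   - natural_matrix u ord0 (lift ord0 j) x t * om (lift ord0 i) (lift ord0 j) x t)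
   = - \sum_j w i j x t * u j x t.
  rewrite -sumrN; apply: eq_bigr => j _.
  have [_ _ _ ->] := natural_matrixE i j x t; have [_ -> _ _] := natural_matrixE j j x t.
  by rewrite mulr0 sub0r mulrC.
by rewrite /hn; lra.
Qed.

Lemma curvature_derive_x x t i : X x -> T t ->
  is_derive x 1 (fun s => u i s t) (ddx (fun s => u i s t) x).
Proof.
move=> Xx Tt; have [[_ us] _ _ _ _] := e_natural.
have [/(_ (x, t)) du _] := us i 1.
rewrite /ddx derive1E; apply: derivableP.
have dd : derivable (fun z : R * R => u i z.1 z.2) (x, t) (1, 0).
  by apply: diff_derivable; apply: du.
exact: (@ex_derive _ _ _ _ _ _ _ (is_derive_x (derivableP dd))).
Qed.

(** The integrals in [Rop] are identified by differentiating the candidates: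
    [h_0] has the derivative [<u, h>], and [<J_ij u, h> - om_ij] has the derivative
    [<J_ij u_x, h>], in which the terms with [h_0] cancel.  Substituted into
    [Rop h], they turn it into [D_x om_0i + sum_j om_ij u_j]. *)
Theorem curvature_evolution x t i : X x -> T t ->
  is_derive t 1 (fun s => u i x s)
    (Rop (@ddx R) Di (slice u t) (slice hn t) i 0 x - kap * hn i x t).
Proof.
move=> Xx Tt; have [Zsub Dinv] := Di_inv; have [Z0 Zw ZJ] := Z_const Tt.
have sE (f : 'I_m -> R -> R -> R) j : slice f t j 0 = (fun s => f j s t) by rewrite mxE.
have [du [dw [Hu Hw E]]] := curvature_derive i Xx Tt.
apply: is_derive_eq Hu _.
(* The right side is [<J_jk u, h> - om_jk], which lies in [Z] because [Z] is stable
   under subtraction. *)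
have rot_int j k : Di (dot (Jmx _ j k *m map_mx (@ddx R) (slice u t)) (slice hn t)) x
    = hn j x t * u k x t - u j x t * hn k x t - w j k x t.
  apply: (etrans (Dinv (dot (Jmx _ j k *m slice u t) (slice hn t) - (fun s => w j k s t))
      _ (Zsub _ _ (ZJ j k) (Zw j k)) _ x Xx)); last by rewrite subr_eval dot_Jmx_eval !sE.
  move=> s Xs; rewrite dot_Jmx_eval !mapmxE !sE.
  have -> : dot (Jmx _ j k *m slice u t) (slice hn t) - (fun s => w j k s t)
      = (fun s => hn j s t * u k s t - u j s t * hn k s t - w j k s t).
    by apply/funext => r; rewrite subr_eval dot_Jmx_eval !sE.
  have D1 := is_derive_fmul (normal_derive j Xs Tt) (curvature_derive_x k Xs Tt).
  have D2 := is_derive_fmul (curvature_derive_x j Xs Tt) (normal_derive k Xs Tt).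
  apply: is_derive_eq (is_deriveB (is_deriveB D1 D2) (rotation_derive j k Xs Tt)) _.
  by ring.
pose A : 'M[R]_m := \matrix_(j, k) (hn j x t * u k x t - u j x t * hn k x t - w j k x t).
rewrite (@Rop_eval _ _ _ _ _ _ _ _ A).
- have -> : Di (dot (slice u t) (slice hn t)) x = h ord0 x t.
    apply: (Dinv (fun s => h ord0 s t) _ Z0 _ x Xx) => s Xs.
    rewrite dot_eval; apply: is_derive_eq (tangential_derive Xs Tt) _.
    by apply: eq_bigr => j _; rewrite !sE.
  rewrite !sE.
  have d2 : ddx (ddx (fun s => hn i s t)) x
      = dw - ((\sum_j u j x t * hn j x t) * u i x t
              + h ord0 x t * ddx (fun s => u i s t) x).
    have D := is_deriveB Hw (is_derive_fmul (tangential_derive Xx Tt) (curvature_derive_x i Xx Tt)).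
    rewrite {1}/ddx derive1E; apply: derive_val; apply: (near_eq_is_derive _ D).
    apply: (near_of_open X_open Xx) => s Xs.
    by rewrite /ddx derive1E (@derive_val _ _ _ _ _ _ _ (normal_derive i Xs Tt)).
  rewrite d2 E.
  under [X in _ = _ - X - _]eq_bigr => j _ do rewrite mxE sE.
  have -> : \sum_j (hn i x t * u j x t - u i x t * hn j x t - w i j x t) * u j x t
     = hn i x t * (\sum_j u j x t * u j x t) - u i x t * (\sum_j u j x t * hn j x t)
       - \sum_j w i j x t * u j x t.
    by rewrite !mulr_sumr -!sumrB; apply: eq_bigr => j _; ring.
  under [X in _ = _ + X * _ + _ - _ - _]eq_bigr => j _ do rewrite !sE.
  ring.
- by move=> j k; rewrite rot_int mxE.
- by move=> j k; rewrite !mxE /w (om_skew (lift ord0 j) (lift ord0 k) Xx Tt); ring.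
- by move=> j; rewrite mxE /w (om_diag _ Xx Tt); ring.
Qed.

End Evolution.

Theorem theorem2 (R : realType) (m : nat) :
  (forall (M : riemannian_manifold R m.+1) (kap : R),
   constant_curvature M kap ->
   forall (X T : set R) (gam : R -> R -> M)
          (e : 'I_m.+1 -> vfield M) (u : 'I_m -> R -> R -> R)
          (N : nat) (O : set 'M[R]_(N.+1, m))
          (hfun : 'I_m.+1 -> 'M[R]_(N.+1, m) -> R)
          (om : 'I_m.+1 -> 'I_m.+1 -> R -> R -> R)
          (Z : set (R -> R)) (Di : (R -> R) -> (R -> R)),
   let h := fun (l : 'I_m.+1) (x t : R) => hfun l (jet N u x t) in
   let hn := fun i : 'I_m => h (lift ord0 i) in
   open X -> is_interval X -> open T -> is_interval T ->
   smooth_family X T gam ->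
   arc_length_preserving X T gam ->
   natural_frame X T gam e u ->
   open O -> (forall x t, X x -> T t -> O (jet N u x t)) ->
   (forall l, smooth_on O (hfun l)) ->
   along_eq X T gam (gam_t gam) (lincomb h e) ->
   (* om is the connection form of the frame, evaluated on d/dt *)
   (forall a, along_eq X T gam (nabla_t gam (e a)) (lincomb (om a) e)) ->
   (* all integration constants are zero *)
   formal_inverse X Z Di ->
   (forall t, T t ->
      [/\ Z (fun x => h ord0 x t),
          forall i j : 'I_m, Z (fun x => om (lift ord0 i) (lift ord0 j) x t)
        & forall i j : 'I_m, Z (dot (Jmx _ i j *m slice u t) (slice hn t))]) ->
   forall x t i, X x -> T t ->
     is_derive t 1 (fun s => u i x s)
       (Rop (@ddx R) Di (slice u t) (slice hn t) i 0 x - kap * hn i x t))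
  /\ hereditary R (@Rop m)
  /\ factorizes R (@Rop m) (@Hop m) (@Iop m)
  /\ symplectic R (@Iop m)
  /\ cosymplectic R (@Hop m).
Proof.
split; last first.
  split; first exact: hereditary_Rop.
  split; first exact: factorizes_Rop.
  by split; [exact: symplectic_Iop|exact: cosymplectic_Hop].
move=> M kap M_curv X T gam e u N O hfun om Z Di h hn X_open _ T_open _ gam_smooth _.
move=> e_natural _ _ _ gam_t_e om_t Di_inv Z_const x t i Xx Tt.
exact: (curvature_evolution M_curv X_open T_open gam_smooth e_natural gam_t_e om_t
  Di_inv Z_const i Xx Tt).
Qed.
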